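(* Let $\mathcal A$ be a finite alphabet. Let $U$ be a recursively enumerable set of equations between $\mu$-expressions over $\mathcal A$ such that (i) $U$ extends $\mu\mathsf S_{\not 1}$, i.e. every equation derivable in $\mu\mathsf S_{\not 1}$ belongs to $U$; and (ii) $U$ is sound for the language model $\mathcal L$, i.e. every equation in $U$ is valid in $\mathcal L$. Then $U$ is $\Sigma^0_1$-complete.
   Context: Expressions. Let $\mathcal A$ be the finite alphabet and $\mathcal V$ a countably infinite set of variables disjoint from $\mathcal A$. The $\mu$-expressions are generated by $$e,f,\dots ::= 0 \mid 1 \mid a\in\mathcal A \mid x\in\mathcal V \mid e+f \mid e\cdot f \mid \mu x\, e,$$ where $\mu x$ binds $x$; expressions are identified up to renaming of bound variables, and $e\cdot f$ is written $ef$. If $e(x)$ is an expression (possibly with further free variables), $e(f)$ is the result of capture-avoiding substitution of $f$ for $x$. An expression is $1$-free if the symbol $1$ does not occur in it. The theory $\mu\mathsf S_{\not 1}$. It is the equational theory over $1$-free $\mu$-expressions whose axioms are all instances, for arbitrary (possibly open) $1$-free $\mu$-expressions, of: $e+(f+g)=(e+f)+g$; $e+f=f+e$; $e+0=e$; $e(fg)=(ef)g$; $e0=0$; $0e=0$; $e(f+g)=ef+eg$; $(e+f)g=eg+fg$; and the fixed point axiom $\mu x\,e(x)=e(\mu x\,e(x))$. Derivations use reflexivity, symmetry, transitivity and congruence for $+$ and $\cdot$; there is no congruence rule for $\mu$ (from $e(x)=f(x)$ one may not infer $\mu x\,e(x)=\mu x\,f(x)$). Language model $\mathcal L$. Expand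 the syntax by a constant for each language $A\subseteq\mathcal A^*$. To each closed expression $e$ of the expanded syntax a language $\mathcal L(e)\subseteq\mathcal A^*$ is assigned: $\mathcal L(0)=\varnothing$, $\mathcal L(1)=\{\varepsilon\}$, $\mathcal L(a)=\{a\}$, $\mathcal L(A)=A$, $\mathcal L(e+f)=\mathcal L(e)\cup\mathcal L(f)$, $\mathcal L(ef)=\{uv: u\in\mathcal L(e), v\in\mathcal L(f)\}$, $\mathcal L(\mu x\,e(x))=\bigcap\{A\subseteq\mathcal A^*:\mathcal L(e(A))\subseteq A\}$. An equation $e(\vec x)=f(\vec x)$ is valid in $\mathcal L$ if $\mathcal L(e(\vec A))=\mathcal L(f(\vec A))$ for all languages $\vec A$. Theories are identified with the set of equations they prove, and sets of equations with sets of natural numbers via a fixed standard coding. $\Sigma^0_1$-complete means r.e. and such that every r.e. set of natural numbers many-one reduces to it.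
   Formalization: The alphabet is assumed to have at least two letters; for an alphabet with no letter or one letter the claim is false, since there a decidable sound extension exists (all valid equations, or equality of Parikh images). *)

(* Defs.v *)
From mathcomp Require Import all_boot.
From mathcomp Require Import boolp classical_sets.
From Stdlib Require Import Arith.Cantor.

Set Implicit Arguments.
Unset Strict Implicit.
Unset Printing Implicit Defensive.

Local Open Scope classical_set_scope.

(* mu-expressions up to renaming of bound variables, in de Bruijn notation:
   under d binders, [Var n] is the variable bound by the n-th enclosing [Mu]
   (counted from the innermost one) if n < d, and the free variable x_(n - d)
   otherwise. *)
Inductive expr (A : Type) : Type :=
| Zero
| One
| Letter of A
| Var of nat
| Plus of expr A & expr A
| Dot of expr A & expr A
| Mu of expr A.

Arguments Zero {A}.
Arguments One {A}.
Arguments Var {A}.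

Definition equation (A : Type) : Type := (expr A * expr A)%type.

Fixpoint one_free (A : Type) (e : expr A) : bool :=
  match e with
  | One => false
  | Zero | Letter _ | Var _ => true
  | Plus e f | Dot e f => one_free e && one_free f
  | Mu e => one_free e
  end.

(* Renumbers the variables of [e] so that index [k] becomes unused. *)
Fixpoint shift (A : Type) (k : nat) (e : expr A) : expr A :=
  match e with
  | Zero => Zero
  | One => One
  | Letter a => Letter a
  | Var n => Var (if n < k then n else n.+1)
  | Plus e f => Plus (shift k e) (shift k f)
  | Dot e f => Dot (shift k e) (shift k f)
  | Mu e => Mu (shift k.+1 e)
  end.

(* Capture-avoiding substitution of [g] for index [k], which disappears: the
   indices above [k] are decremented. Thus if [Mu e] stands for mu x e(x), then
   [subst 0 g e] stands for e(g). *)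
Fixpoint subst (A : Type) (k : nat) (g e : expr A) : expr A :=
  match e with
  | Zero => Zero
  | One => One
  | Letter a => Letter a
  | Var n => if n < k then Var n else if n == k then g else Var n.-1
  | Plus e f => Plus (subst k g e) (subst k g f)
  | Dot e f => Dot (subst k g e) (subst k g f)
  | Mu e => Mu (subst k.+1 (shift 0 g) e)
  end.

(* The theory of 1-free expressions; there is no congruence rule for [Mu]. *)
Inductive derivable (A : Type) : expr A -> expr A -> Prop :=
| der_addA e f g : one_free e -> one_free f -> one_free g ->
    derivable (Plus e (Plus f g)) (Plus (Plus e f) g)
| der_addC e f : one_free e -> one_free f ->
    derivable (Plus e f) (Plus f e)
| der_add0 e : one_free e -> derivable (Plus e Zero) e
| der_mulA e f g : one_free e -> one_free f -> one_free g ->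
    derivable (Dot e (Dot f g)) (Dot (Dot e f) g)
| der_mule0 e : one_free e -> derivable (Dot e Zero) Zero
| der_mul0e e : one_free e -> derivable (Dot Zero e) Zero
| der_mulDr e f g : one_free e -> one_free f -> one_free g ->
    derivable (Dot e (Plus f g)) (Plus (Dot e f) (Dot e g))
| der_mulDl e f g : one_free e -> one_free f -> one_free g ->
    derivable (Dot (Plus e f) g) (Plus (Dot e g) (Dot f g))
| der_fix e : one_free e -> derivable (Mu e) (subst 0 (Mu e) e)
| der_refl e : one_free e -> derivable e e
| der_sym e f : derivable e f -> derivable f e
| der_trans e f g : derivable e f -> derivable f g -> derivable e g
| der_add e e' f f' : derivable e e' -> derivable f f' ->
    derivable (Plus e f) (Plus e' f')
| der_mul e e' f f' : derivable e e' -> derivable f f' ->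
    derivable (Dot e f) (Dot e' f').

Definition language (A : Type) : Type := set (seq A).

Definition env_cons (A : Type) (B : language A) (rho : nat -> language A)
    (n : nat) : language A :=
  if n is m.+1 then rho m else B.

(* [lang rho e] is the language of the closed expression obtained from [e] by
   substituting a constant for the language [rho n] for each free variable
   x_n. *)
Fixpoint lang (A : Type) (rho : nat -> language A) (e : expr A) : language A :=
  match e with
  | Zero => set0
  | One => [set [::]]
  | Letter a => [set [:: a]]
  | Var n => rho n
  | Plus e f => lang rho e `|` lang rho f
  | Dot e f => [set u ++ v | u in lang rho e & v in lang rho f]
  | Mu e => \bigcap_(B in [set B | lang (env_cons B rho) e `<=` B]) B
  end.

Definition valid (A : Type) (e f : expr A) : Prop :=
  forall rho : nat -> language A, lang rho e = lang rho f.

(* Partial recursive functions. All functions are unary; several arguments are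
   packed into one number by the Cantor pairing function. *)
Inductive recfun : Type :=
| RZero
| RSucc
| RFst
| RSnd
| RPair of recfun & recfun
| RComp of recfun & recfun
| RPrec of recfun & recfun
| RMin of recfun.

Definition cpair (x y : nat) : nat := Cantor.to_nat (x, y).

Fixpoint prec_graph (F G : nat -> nat -> Prop) (a n y : nat) : Prop :=
  if n is m.+1 then exists z, prec_graph F G a m z /\ G (cpair a (cpair m z)) y
  else F a y.

(* [eval c x y]: the partial function coded by [c] is defined at [x], with
   value [y]. *)
Fixpoint eval (c : recfun) (x y : nat) : Prop :=
  match c with
  | RZero => y = 0
  | RSucc => y = x.+1
  | RFst => y = (Cantor.of_nat x).1
  | RSnd => y = (Cantor.of_nat x).2
  | RPair f g => exists u v, [/\ eval f x u, eval g x v & y = cpair u v]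
  | RComp f g => exists z, eval g x z /\ eval f z y
  | RPrec f g =>
      prec_graph (eval f) (eval g) (Cantor.of_nat x).1 (Cantor.of_nat x).2 y
  | RMin f => eval f (cpair x y) 0 /\
      forall m, m < y -> exists k, eval f (cpair x m) k.+1
  end.

Definition computable (f : nat -> nat) : Prop :=
  exists c : recfun, forall x, eval c x (f x).

Definition rec_enum (P : set nat) : Prop :=
  exists c : recfun, forall n, P n <-> exists y, eval c n y.

Definition many_one_reducible (P Q : set nat) : Prop :=
  exists2 f : nat -> nat, computable f & forall n, P n <-> Q (f n).

Definition sigma01_complete (Q : set nat) : Prop :=
  rec_enum Q /\ forall P : set nat, rec_enum P -> many_one_reducible P Q.

(* The coding of letters depends on the chosen enumeration of the alphabet, but
   only up to a permutation of a finite set. *)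
Fixpoint expr_code (A : finType) (e : expr A) : nat :=
  match e with
  | Zero => cpair 0 0
  | One => cpair 1 0
  | Letter a => cpair 2 (enum_rank a)
  | Var n => cpair 3 n
  | Plus e f => cpair 4 (cpair (expr_code e) (expr_code f))
  | Dot e f => cpair 5 (cpair (expr_code e) (expr_code f))
  | Mu e => cpair 6 (expr_code e)
  end.

Definition equation_code (A : finType) (E : equation A) : nat :=
  cpair (expr_code E.1) (expr_code E.2).

Definition codes (A : finType) (U : set (equation A)) : set nat :=
  [set equation_code E | E in U].

(* Main.v *)
From HB Require Import structures.
Require Import Defs.
From mathcomp Require Import all_boot.
From mathcomp Require Import boolp classical_sets.
From mathcomp Require Import zify.
From Stdlib Require Import Arith.Cantor.

(** The set U is recursively enumerable, contains every derivable equation and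
    no invalid one. It is therefore enough to encode computations into equations
    so finely that one outcome makes the equation derivable and the other makes
    it invalid: U then separates two effectively inseparable sets, and the
    usual diagonal argument makes it complete.

    The encoding. A counter program c, whose instructions increment a register
    or test it for zero, has a mu-expression [paths c] whose words are its
    control-flow paths: sequences of events (increment, decrement, zero test)
    that obey the control structure of c and ignore the contents of the
    registers. Free variables play the role of the letters for the events. A
    path is an execution when every decrement finds a positive register and
    every zero test a null one. This is a property of one register at a time,
    and its violation in a prefix is context-free; [faulty c] generates the
    words with a violation. With [runs c m], all paths of c on input m followed
    by a decrement of register 0, the equation [faulty c + runs c m = faulty c]
    says that no execution on input m ends with a positive register 0.

    If c halts on m with register 0 null, the equation is derivable
    ([derivable_faulty]): unfolding the fixed points of [runs c m] along the
    execution, each branch that leaves it commits a violation at once, and the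
    last decrement is a violation too, so finitely many unfoldings suffice.
    Addition is not idempotent in this theory. The role of inclusion is
    played by absorption, derivability of h + g = h, and each alternative e of
    the grammar of [faulty c] is written as the fixed point mu x (x + e), which
    absorbs e. If c halts on m with register 0 positive, the execution is a word
    of [runs c m] outside [faulty c], and the equation is invalid
    ([not_valid_faulty]): two letters of the alphabet suffice to spell the
    events by a prefix code.

    Programs of this kind compute all partial recursive functions
    ([exec_compile]). Given a recursively enumerable P, let c search for the
    least k at which either n is seen in P after k steps (result 0) or the code
    of the equation of c on its own input is seen in U after k steps (result
    1); the program gets the expressions that enter its own equation as part of
    its input, so no general recursion theorem is needed. If U contained
    the equation while n is not in P, c would halt with 1 and the equation would
    be invalid. If n is in P, then c halts; with result 0 the equation is
    derivable, hence in U, and with result 1 it has been seen in U. So n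
    is in P exactly when the equation is in U. *)

Set Implicit Arguments.
Unset Strict Implicit.
Unset Printing Implicit Defensive.

(** * Substitution and shifting *)

Section Substitution.
Variable A : Type.
Implicit Types (e g : expr A) (rho : nat -> language A).

Lemma one_free_shift k e : one_free (shift k e) = one_free e.
Proof. by elim: e k => //= [e IHe f IHf|e IHe f IHf] k; rewrite IHe IHf. Qed.

Lemma subst_shiftK k g e : subst k g (shift k e) = e.
Proof.
elim: e k g => //= [n|e IHe f IHf|e IHe f IHf|e IHe] k g; rewrite ?IHe ?IHf //.
have [nk|kn] := ltnP n k; first by rewrite nk.
by rewrite ltnNge leqW //= eq_sym ltn_eqF.
Qed.

Lemma shift_shift j k e :
  j <= k -> shift j (shift k e) = shift k.+1 (shift j e).
Proof.
elim: e j k => //= [n|e IHe f IHf|e IHe f IHf|e IHe] j k jk; first last.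
- by rewrite (IHe j.+1 k.+1).
- by rewrite (IHe j k jk) (IHf j k jk).
- by rewrite (IHe j k jk) (IHf j k jk).
congr Var; have [nk|kn] := ltnP n k.
  by case: (ltnP n j) => nj; rewrite ltnS; [rewrite (ltnW nk)|rewrite nk].
have jn := leq_trans jk kn.
have [-> ->] : (n < j = false) /\ (n.+1 < j = false).
  by split; apply/negbTE; lia.
by rewrite ltnS [n < k]ltnNge kn.
Qed.

Lemma subst_shift j k g e : j <= k ->
  subst k.+1 (shift j g) (shift j e) = shift j (subst k g e).
Proof.
elim: e j k g => //= [n|e IHe f IHf|e IHe f IHf|e IHe] j k g jk.
- have [nj|jn] := ltnP n j.
    have nk := leq_trans nj jk.
    by rewrite (leqW nk) /= nk /= nj.
  have [nk|kn|->] := ltngtP n k.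
  + by rewrite ltnS nk /= ltnNge jn.
  + case: n kn jn => // n kn jn.
    have jn1 : n < j = false by apply/negbTE; rewrite -leqNgt (leq_trans jk).
    by rewrite ltnS [n.+1 < k]ltnNge (ltnW kn) /= eqSS gtn_eqF //= jn1.
  + by rewrite ltnS ltnn eqxx.
- by rewrite IHe ?IHf.
- by rewrite IHe ?IHf.
- by rewrite shift_shift // IHe.
Qed.

Lemma lang_shift_gen k rho rho' e :
  (forall n, rho' (if n < k then n else n.+1) = rho n) ->
  lang rho' (shift k e) = lang rho e.
Proof.
elim: e k rho rho' => //= [e IHe f IHf|e IHe f IHf|e IHe] k rho rho' E.
- by rewrite (IHe _ _ _ E) (IHf _ _ _ E).
- by rewrite (IHe _ _ _ E) (IHf _ _ _ E).
- suff E' B : lang (env_cons B rho') (shift k.+1 e) = lang (env_cons B rho) e.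
    by congr bigcap; apply: funext => B /=; rewrite E'.
  by apply: IHe => -[//|n] /=; rewrite ltnS -E; case: ifP.
Qed.

Lemma lang_shift B rho e : lang (env_cons B rho) (shift 0 e) = lang rho e.
Proof. exact: lang_shift_gen. Qed.

End Substitution.

Lemma In_map (T : eqType) (B : Type) (f : T -> B) (x : T) (s : seq T) :
  x \in s -> List.In (f x) [seq f y | y <- s].
Proof. by elim: s => //= y s IH; rewrite inE => /orP[/eqP->|/IH]; auto. Qed.

Lemma In_cat_forall (T : Type) (P : T -> Prop) (s t : seq T) :
  (forall x, List.In x (s ++ t) -> P x) ->
  (forall x, List.In x s -> P x) /\ (forall x, List.In x t -> P x).
Proof.
by move=> st; split=> x xs; apply: st; apply/List.in_app_iff; auto.
Qed.

(** * Absorption *)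

Section Absorption.
Variable A : Type.
Implicit Types (e f g h k : expr A).

(** Stands in for the inclusion of [g] in [h]. As addition is not idempotent, it
    is not reflexive. *)
Definition absorbed g h := derivable (Plus h g) h.

Lemma derivable_one_free e f : derivable e f -> one_free e && one_free f.
Proof.
have subst_of (k : nat) g e0 :
    one_free g -> one_free e0 -> one_free (subst k g e0).
  elim: e0 k g => //= [n|a IHa b IHb|a IHa b IHb|a IHa] k g ofg.
  - by case: ifP => // _; case: ifP.
  - by case/andP=> /(IHa k g ofg) -> /(IHb k g ofg) ->.
  - by case/andP=> /(IHa k g ofg) -> /(IHb k g ofg) ->.
  - by apply: IHa; rewrite one_free_shift.
elim=> {e f} //=.
- by move=> ? ? ? -> -> ->.
- by move=> ? ? -> ->.
- by move=> ? ->.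
- by move=> ? ? ? -> -> ->.
- by move=> ? ->.
- by move=> ? ->.
- by move=> ? ? ? -> -> ->.
- by move=> ? ? ? -> -> ->.
- by move=> e ofe; rewrite ofe subst_of.
- by move=> ? ->.
- by move=> ? ? _ /andP[-> ->].
- by move=> ? ? ? _ /andP[-> _] _ /andP[_ ->].
- by move=> ? ? ? ? _ /andP[-> ->] _ /andP[-> ->].
- by move=> ? ? ? ? _ /andP[-> ->] _ /andP[-> ->].
Qed.

Lemma derivable_ofl e f : derivable e f -> one_free e.
Proof. by case/derivable_one_free/andP. Qed.

Lemma derivable_ofr e f : derivable e f -> one_free f.
Proof. by case/derivable_one_free/andP. Qed.

Lemma absorbed_ofl g h : absorbed g h -> one_free g.
Proof. by move/derivable_ofl=> /andP[]. Qed.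

Lemma absorbed_ofr g h : absorbed g h -> one_free h.
Proof. exact: derivable_ofr. Qed.

Lemma absorbed_eql g g' h : derivable g g' -> absorbed g' h -> absorbed g h.
Proof.
move=> E g'h; apply: der_trans (g'h); apply: der_add E.
exact/der_refl/(absorbed_ofr g'h).
Qed.

Lemma absorbed_eqr g h h' : derivable h h' -> absorbed g h' -> absorbed g h.
Proof.
move=> E gh'; apply: der_trans (der_sym E); apply: der_trans (gh').
by apply: der_add E _; exact/der_refl/(absorbed_ofl gh').
Qed.

Lemma absorbed_plusl g h k :
  one_free k -> absorbed g h -> absorbed g (Plus h k).
Proof.
move=> ofk gh; have [ofg ofh] := (absorbed_ofl gh, absorbed_ofr gh).
apply: (der_trans (der_sym (der_addA ofh ofk ofg))).
apply: (der_trans (der_add (der_refl ofh) (der_addC ofk ofg))).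
by apply: (der_trans (der_addA ofh ofg ofk)); apply: der_add gh (der_refl ofk).
Qed.

Lemma absorbed_plusr g h k :
  one_free k -> absorbed g h -> absorbed g (Plus k h).
Proof.
move=> ofk gh; apply: absorbed_eqr (absorbed_plusl ofk gh).
exact: der_addC ofk (absorbed_ofr gh).
Qed.

Lemma absorbed_plus g g' h :
  absorbed g h -> absorbed g' h -> absorbed (Plus g g') h.
Proof.
move=> gh g'h; apply: der_trans (g'h).
have [[ofg ofg'] ofh] := (absorbed_ofl gh, absorbed_ofl g'h, absorbed_ofr gh).
apply: (der_trans (der_addA ofh ofg ofg')).
by apply: der_add gh (der_refl ofg').
Qed.

Lemma absorbed_trans f g h : absorbed f g -> absorbed g h -> absorbed f h.
Proof.
move=> fg gh.
have [[off ofg] ofh] := (absorbed_ofl fg, absorbed_ofl gh, absorbed_ofr gh).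
apply: der_trans (gh).
apply: (der_trans (der_add (der_sym gh) (der_refl off))).
apply: (der_trans (der_sym (der_addA ofh ofg off))).
exact: der_add (der_refl ofh) fg.
Qed.

Lemma absorbed_dotl g h k :
  one_free k -> absorbed g h -> absorbed (Dot k g) (Dot k h).
Proof.
move=> ofk gh; have [ofg ofh] := (absorbed_ofl gh, absorbed_ofr gh).
apply: (der_trans (der_sym (der_mulDr ofk ofh ofg))).
exact: der_mul (der_refl ofk) gh.
Qed.

Lemma absorbed_dotr g h k :
  one_free k -> absorbed g h -> absorbed (Dot g k) (Dot h k).
Proof.
move=> ofk gh; have [ofg ofh] := (absorbed_ofl gh, absorbed_ofr gh).
apply: (der_trans (der_sym (der_mulDl ofh ofg ofk))).
exact: der_mul gh (der_refl ofk).
Qed.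

Lemma absorbed_dot g g' h h' :
  absorbed g h -> absorbed g' h' -> absorbed (Dot g g') (Dot h h').
Proof.
move=> gh gh'; apply: absorbed_trans (absorbed_dotr (absorbed_ofl gh') gh) _.
exact: absorbed_dotl (absorbed_ofr gh) gh'.
Qed.

(** The fixed point mu x (x + e), an infinite sum of copies of e: it has the
    language of e, and the fixed point axiom makes it absorb e. *)
Definition many e := Mu (Plus (Var 0) (shift 0 e)).

Fixpoint alt (es : seq (expr A)) : expr A :=
  if es is e :: es' then Plus (many e) (alt es') else Zero.

Lemma one_free_alt es : one_free (alt es) = all (@one_free A) es.
Proof. by elim: es => //= e es ->; rewrite one_free_shift. Qed.

Lemma absorbed_many e : one_free e -> absorbed e (many e).
Proof.
move=> ofe; apply: der_sym.
have := @der_fix _ (Plus (Var 0) (shift 0 e)).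
by rewrite /= subst_shiftK one_free_shift; exact.
Qed.

Lemma absorbed_alt e es : all (@one_free A) es -> List.In e es ->
  absorbed e (alt es).
Proof.
elim: es => //= f es IH /andP[off ofes] [<-|/(IH ofes) ees].
  by apply: absorbed_plusl (absorbed_many off); rewrite one_free_alt.
by apply: absorbed_plusr => //; rewrite /= one_free_shift.
Qed.

Lemma subst_alt (k : nat) g es :
  subst k g (alt es) = alt [seq subst k g e | e <- es].
Proof. by elim: es => //= e es ->; rewrite subst_shift. Qed.

(** A nonterminal with the alternatives [es], in which [Var 0] is the
    nonterminal itself. Since each alternative is repeated by [many], the
    nonterminal absorbs its alternatives one by one. *)
Definition choice es := Mu (alt es).

Lemma one_free_choice es : one_free (choice es) = all (@one_free A) es.
Proof. exact: one_free_alt. Qed.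

Lemma absorbed_choice es : all (@one_free A) es ->
  forall e, List.In e [seq subst 0 (choice es) e | e <- es] ->
  absorbed e (choice es).
Proof.
move=> ofes e ees; have /der_fix fixes : one_free (alt es).
  by rewrite one_free_alt.
apply: absorbed_eqr (fixes) _.
rewrite subst_alt; apply: absorbed_alt ees.
by have := derivable_ofr fixes; rewrite subst_alt one_free_alt.
Qed.

Lemma lang_many rho e : (lang rho (many e) `<=` lang rho e)%classic.
Proof.
move=> x /(_ (lang rho e)); apply => y [//|].
by rewrite -{2}(lang_shift (lang rho e) rho e).
Qed.

Lemma lang_alt rho es x :
  lang rho (alt es) x -> exists2 e, List.In e es & lang rho e x.
Proof.
elim: es => //= e es IH [/lang_many xe|/IH[f fes xf]]; first by exists e; auto.
by exists f; auto.
Qed.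

(** Induction on derivations from a nonterminal: a language closed under each of
    its alternatives bounds it from above. *)
Lemma lang_choice rho es (B : language A) :
  (forall e, List.In e es -> lang (env_cons B rho) e `<=` B)%classic ->
  (lang rho (choice es) `<=` B)%classic.
Proof.
move=> closedB x; apply => y /lang_alt[e /closedB].
exact.
Qed.

End Absorption.

(** * Counter programs and the words of their control flow *)

Definition store := nat -> nat.

Definition upd (r v : nat) (st : store) : store :=
  fun s => if s == r then v else st s.

(** [Tick] touches no register, and [Null r] stands for a successful zero
    test. *)
Inductive event := Tick | Up of nat | Down of nat | Null of nat.

(** The free variable that stands for an event. *)
Definition event_index (a : event) : nat :=
  match a with
  | Tick => 0
  | Up r => (3 * r).+1
  | Down r => (3 * r).+2
  | Null r => (3 * r).+3
  end.

Lemma event_index_inj : injective event_index.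
Proof. by case=> [|r|r|r] [|s|s|s] //=; move=> E; try congr (_ _); lia. Qed.

HB.instance Definition _ := Equality.copy event (inj_type event_index_inj).

Definition event_reg (a : event) : nat :=
  match a with Tick => 0 | Up r | Down r | Null r => r end.

Definition act (st : store) (a : event) : store :=
  match a with
  | Tick | Null _ => st
  | Up r => upd r (st r).+1 st
  | Down r => upd r (st r).-1 st
  end.

Definition enabled (st : store) (a : event) : bool :=
  match a with
  | Tick | Up _ => true
  | Down r => 0 < st r
  | Null r => st r == 0
  end.

(** [If r c1 c2] and [Loop r c] decrement register [r] on entering [c1] or the
    body [c], so that a conditional is a choice between two events. *)
Inductive cmd : Type :=
| Skip
| Inc of nat
| Seq of cmd & cmd
| If of nat & cmd & cmd
| Loop of nat & cmd.

Inductive exec : cmd -> store -> store -> Prop :=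
| exec_skip st : exec Skip st st
| exec_inc r st : exec (Inc r) st (act st (Up r))
| exec_seq c1 c2 st st1 st2 :
    exec c1 st st1 -> exec c2 st1 st2 -> exec (Seq c1 c2) st st2
| exec_if_pos r c1 c2 st st1 : 0 < st r ->
    exec c1 (act st (Down r)) st1 -> exec (If r c1 c2) st st1
| exec_if_zero r c1 c2 st st1 : st r = 0 ->
    exec c2 st st1 -> exec (If r c1 c2) st st1
| exec_loop_pos r c st st1 st2 : 0 < st r ->
    exec c (act st (Down r)) st1 -> exec (Loop r c) st1 st2 ->
    exec (Loop r c) st st2
| exec_loop_zero r c st : st r = 0 -> exec (Loop r c) st st.

Fixpoint regs (c : cmd) : nat :=
  match c with
  | Skip => 0
  | Inc r => r.+1
  | Seq c1 c2 => maxn (regs c1) (regs c2)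
  | If r c1 c2 => maxn r.+1 (maxn (regs c1) (regs c2))
  | Loop r c1 => maxn r.+1 (regs c1)
  end.

Section Grammar.
Variable A : Type.
Implicit Types (e f g h W M N E R : expr A) (st : store) (c : cmd).

Definition ev (a : event) : expr A := Var (event_index a).

Fixpoint paths (c : cmd) : expr A :=
  match c with
  | Skip => ev Tick
  | Inc r => ev (Up r)
  | Seq c1 c2 => Dot (paths c1) (paths c2)
  | If r c1 c2 =>
      Plus (Dot (ev (Down r)) (paths c1)) (Dot (ev (Null r)) (paths c2))
  | Loop r c1 =>
      Mu (Plus (Dot (shift 0 (ev (Down r))) (Dot (shift 0 (paths c1)) (Var 0)))
               (shift 0 (ev (Null r))))
  end.

(** What remains to be executed after a violation is a product of these
    expressions. *)
Fixpoint subpaths (c : cmd) : seq (expr A) :=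
  paths c :: match c with
  | Skip | Inc _ => [::]
  | Seq c1 c2 | If _ c1 c2 => subpaths c1 ++ subpaths c2
  | Loop _ c1 => subpaths c1
  end.

Lemma one_free_paths c : one_free (paths c).
Proof.
elim: c => //= [c1 -> c2 ->|r c1 -> c2 ->|r c1 IH] //.
by rewrite one_free_shift IH.
Qed.

Lemma one_free_subpaths c : all (@one_free A) (subpaths c).
Proof.
elim: c => //= [c1 IH1 c2 IH2|r c1 IH1 c2 IH2|r c1 IH1].
- by rewrite all_cat IH1 IH2 !one_free_paths.
- by rewrite all_cat IH1 IH2 !one_free_paths.
- by rewrite one_free_shift one_free_paths IH1.
Qed.

Lemma paths_in_subpaths c : List.In (paths c) (subpaths c).
Proof. by case: c => /=; left. Qed.

Definition events (K : nat) : seq event :=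
  Tick :: flatten [seq [:: Up r; Down r; Null r] | r <- iota 0 K].

Definition neutral (r : nat) (a : event) : bool :=
  (a != Up r) && (a != Down r).

Lemma mem_events K a : a \in events K = (a == Tick) || (event_reg a < K).
Proof.
rewrite in_cons; case: eqP => //= aT.
apply/flattenP/idP => [[_ /mapP[r + ->]]|aK].
  by rewrite mem_iota !inE => /andP[_ rK] /or3P[] /eqP->.
exists [:: Up (event_reg a); Down (event_reg a); Null (event_reg a)].
  by apply/mapP; exists (event_reg a); rewrite ?mem_iota.
by rewrite !inE; case: a aT {aK} => //= r _; rewrite eqxx ?orbT.
Qed.

Definition neutrals (K r : nat) : expr A :=
  alt [seq ev a | a <- events K & neutral r a].

Lemma one_free_neutrals K r : one_free (neutrals K r).
Proof. by rewrite one_free_alt all_map; apply/allP. Qed.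

Lemma absorbed_neutrals K r a :
  a \in events K -> neutral r a -> absorbed (ev a) (neutrals K r).
Proof.
move=> aK ar; apply: absorbed_alt; first by rewrite all_map; apply/allP.
by apply: In_map; rewrite mem_filter ar.
Qed.

Lemma one_free_ev a : one_free (ev a).
Proof. by []. Qed.

(* Simplification must not expand these expressions inside larger ones. *)
Opaque ev neutrals.

(** Words with one increment of register [r] more than decrements. Climbing by
    two and then decrementing replaces the usual Dyck grammar, whose empty words
    have no counterpart among 1-free expressions. *)
Definition climb (K r : nat) : expr A :=
  choice [:: shift 0 (ev (Up r));
             Dot (Var 0) (shift 0 (neutrals K r));
             Dot (Dot (Var 0) (Var 0)) (shift 0 (ev (Down r)))].

Lemma one_free_climb K r : one_free (climb K r).
Proof. by rewrite /climb /= !one_free_shift one_free_neutrals !one_free_ev. Qed.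

Lemma absorbed_climb K r e :
  List.In e [:: ev (Up r);
             Dot (climb K r) (neutrals K r);
             Dot (Dot (climb K r) (climb K r)) (ev (Down r))] ->
  absorbed e (climb K r).
Proof.
have := one_free_climb K r; rewrite /climb one_free_choice.
move/absorbed_choice => /(_ e); rewrite -/(climb K r).
by move: (climb K r) => X; rewrite /= !subst_shiftK.
Qed.

Opaque climb.

(** Words starting with [Tick] with as many increments of [r] as decrements. *)
Definition level0 (K r : nat) : expr A :=
  choice [:: shift 0 (ev Tick);
             Dot (Var 0) (shift 0 (neutrals K r));
             Dot (Dot (Var 0) (shift 0 (climb K r))) (shift 0 (ev (Down r)))].

Lemma one_free_level0 K r : one_free (level0 K r).
Proof.
rewrite /level0 /= !one_free_shift one_free_neutrals one_free_climb.
by rewrite !one_free_ev.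
Qed.

Lemma absorbed_level0 K r e :
  List.In e [:: ev Tick;
             Dot (level0 K r) (neutrals K r);
             Dot (Dot (level0 K r) (climb K r)) (ev (Down r))] ->
  absorbed e (level0 K r).
Proof.
have := one_free_level0 K r; rewrite /level0 one_free_choice.
move/absorbed_choice => /(_ e); rewrite -/(level0 K r).
by move: (level0 K r) => X; rewrite /= !subst_shiftK.
Qed.

Opaque level0.

(** Absorbs the executions, on registers below [K], after which register [r]
    contains [n]. *)
Definition level (K r n : nat) : expr A :=
  iter n (fun e => Dot e (climb K r)) (level0 K r).

Lemma one_free_level K r n : one_free (level K r n).
Proof.
by elim: n => [|n IH]; [exact: one_free_level0|rewrite /= IH one_free_climb].
Qed.

(** All levels except 0 at once. *)
Definition positive (K r : nat) : expr A :=
  choice [:: Dot (shift 0 (level0 K r)) (shift 0 (climb K r));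
             Dot (Var 0) (shift 0 (climb K r))].

Lemma one_free_positive K r : one_free (positive K r).
Proof.
by rewrite /positive /= !one_free_shift one_free_level0 one_free_climb.
Qed.

Lemma absorbed_positive K r n : absorbed (level K r n.+1) (positive K r).
Proof.
have := @absorbed_choice A
  [:: Dot (shift 0 (level0 K r)) (shift 0 (climb K r));
      Dot (Var 0) (shift 0 (climb K r))].
rewrite -/(positive K r); move: (positive K r) => T.
rewrite /= !one_free_shift one_free_level0 one_free_climb !subst_shiftK.
move=> /(_ isT) absT; elim: n => [|n IH]; first by apply: absT; left.
apply: absorbed_trans (absT _ (or_intror (or_introl erefl))).
exact: absorbed_dotr (one_free_climb K r) IH.
Qed.

Opaque positive.

(** Absorbs every product of expressions of [es]. The fixed points that may still
    be waiting behind a violation occur in it literally: without an induction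
    rule, a derivation could only go on unfolding them. *)
Definition leftovers (es : seq (expr A)) : expr A :=
  choice (Dot (Var 0) (Var 0) :: [seq shift 0 e | e <- es]).

Lemma one_free_leftovers es : one_free (leftovers es) = all (@one_free A) es.
Proof.
rewrite one_free_choice /= all_map.
by apply: eq_all => e; apply: one_free_shift.
Qed.

Lemma absorbed_leftovers es e :
  all (@one_free A) es -> List.In e es -> absorbed e (leftovers es).
Proof.
rewrite -one_free_leftovers one_free_choice => ofes ees.
apply: (@absorbed_choice A (_ :: _) ofes); right.
rewrite -map_comp (_ : map _ es = es) //.
by rewrite -[RHS]map_id; apply: eq_map => f /=; rewrite subst_shiftK.
Qed.

Lemma absorbed_leftovers_dot es M N :
  absorbed M (leftovers es) -> absorbed N (leftovers es) ->
  absorbed (Dot M N) (leftovers es).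
Proof.
move=> MR NR; apply: absorbed_trans (absorbed_dot MR NR) _.
have := absorbed_ofr MR; rewrite one_free_choice => ofes.
by apply: (@absorbed_choice A (_ :: _) ofes); left.
Qed.

(** A decrement at 0 or a zero test at a positive level, at the end of the word
    or followed by [R]: without 1, the empty continuation is a case of its
    own. *)
Definition misstep (K r : nat) (R : expr A) : seq (expr A) :=
  [:: Dot (level0 K r) (ev (Down r));
      Dot (Dot (level0 K r) (ev (Down r))) R;
      Dot (positive K r) (ev (Null r));
      Dot (Dot (positive K r) (ev (Null r))) R].

Definition faults (K : nat) (R : expr A) : expr A :=
  alt [seq alt (misstep K r R) | r <- iota 0 K].

Lemma absorbed_faults K R r e : one_free R -> r < K ->
  List.In e (misstep K r R) -> absorbed e (faults K R).
Proof.
move=> ofR rK er; have ofm s : all (@one_free A) (misstep K s R).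
  by rewrite /= one_free_level0 one_free_positive ofR !one_free_ev.
apply: absorbed_trans (absorbed_alt (ofm r) er) (absorbed_alt _ _).
  by rewrite all_map; apply/allP => s _; have := ofm s; rewrite -one_free_alt.
by apply: (In_map (fun r => alt (misstep K r R))); rewrite mem_iota.
Qed.

Lemma level_neutral K r n :
  absorbed (Dot (level K r n) (neutrals K r)) (level K r n).
Proof.
case: n => [|n]; first by apply: absorbed_level0; right; left.
have ofX := one_free_climb K r; have ofL := one_free_level K r n.
apply: absorbed_eql (der_sym (der_mulA ofL ofX (one_free_neutrals K r))) _.
by apply: absorbed_dotl ofL _; apply: absorbed_climb; right; left.
Qed.

Lemma level_down K r n :
  absorbed (Dot (level K r n.+1) (ev (Down r))) (level K r n).
Proof.
case: n => [|n]; first by apply: absorbed_level0; right; right; left.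
have ofX := one_free_climb K r; have ofL := one_free_level K r n.
have ofd := one_free_ev (Down r).
have ofXX : one_free (Dot (climb K r) (climb K r)).
  by rewrite /= ofX.
apply: absorbed_eql (_ : absorbed (Dot (level K r n) _) _).
  apply: (der_trans (der_mul (der_sym (der_mulA ofL ofX ofX)) (der_refl ofd))).
  exact: der_sym (der_mulA ofL ofXX ofd).
by apply: absorbed_dotl ofL _; apply: absorbed_climb; right; right; left.
Qed.

(** [W] is the past of an execution that has reached [st]. Only its counting
    properties matter, hence no word is needed. *)
Definition tracks (K : nat) W st :=
  one_free W /\ forall r, r < K -> absorbed W (level K r (st r)).

Lemma tracks_act K W st a : tracks K W st -> a \in events K ->
  enabled st a -> tracks K (Dot W (ev a)) (act st a).
Proof.
move=> [ofW trW] aK ena; split=> [|r rK]; first by rewrite /= ofW one_free_ev.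
have trWr := trW r rK; have [neu|] := boolP (neutral r a).
  have -> : act st a r = st r.
    case: a neu {aK ena} => //= s neu; rewrite /upd; case: eqP => // rs;
      by rewrite /neutral rs eqxx ?andbF in neu.
  by apply: absorbed_trans (absorbed_dot trWr (absorbed_neutrals aK neu)) _;
    apply: level_neutral.
rewrite negb_and !negbK => /orP[] /eqP E; rewrite {a}E in aK ena *.
- rewrite /= /upd eqxx; apply: absorbed_dot trWr _.
  by apply: absorbed_climb; left.
- rewrite /= /upd eqxx; move: ena trWr => /=.
  case: (st r) => //= n _ trWr.
  exact: absorbed_trans (absorbed_dotr (one_free_ev _) trWr) (level_down K r n).
Qed.

Lemma tracks_stuck K W st a R : tracks K W st -> a \in events K ->
  ~~ enabled st a -> one_free R ->
  absorbed (Dot W (ev a)) (faults K R) /\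
  forall M, absorbed M R -> absorbed (Dot (Dot W (ev a)) M) (faults K R).
Proof.
move=> [ofW trW] aK stuck ofR.
suff [e [eK eRK We]] : exists e, [/\ absorbed e (faults K R),
    absorbed (Dot e R) (faults K R) & absorbed (Dot W (ev a)) e].
  split=> [|M MR]; first exact: absorbed_trans We eK.
  exact: absorbed_trans (absorbed_dot We MR) eRK.
move: aK; rewrite mem_events.
case: a stuck => //= r stuck rK; have trWr := trW r rK.
- exists (Dot (level0 K r) (ev (Down r))).
  split; last apply: absorbed_dotr (one_free_ev _) _.
  + by apply: (absorbed_faults ofR rK); left.
  + by apply: (absorbed_faults ofR rK); right; left.
  + by move: stuck trWr => /=; case: (st r).
- exists (Dot (positive K r) (ev (Null r))).
  split; last apply: absorbed_dotr (one_free_ev _) _.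
  + by apply: (absorbed_faults ofR rK); right; right; left.
  + by apply: (absorbed_faults ofR rK); right; right; right; left.
  + move: stuck trWr => /=; case: (st r) => // n _ trWr.
    exact: absorbed_trans trWr (absorbed_positive K r n).
Qed.

(** No execution that has reached [st] can be completed along [M]. *)
Definition refuted K R st M :=
  forall W, tracks K W st -> absorbed (Dot W M) (faults K R).

(** Of the two branches of a test, the one that contradicts [st] is a misstep,
    absorbed whatever follows; only the other one needs a refutation. *)
Lemma refuted_branch K R r st E M N : r < K -> one_free R ->
  derivable E (Plus (Dot (ev (Down r)) M) (Dot (ev (Null r)) N)) ->
  absorbed M R -> absorbed N R ->
  (if st r == 0 then refuted K R st N else refuted K R (act st (Down r)) M) ->
  refuted K R st E.
Proof.
move=> rK ofR defE MR NR refu W trW; have [ofW _] := trW.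
have [ofM ofN] := (absorbed_ofl MR, absorbed_ofl NR).
have [ofd ofz] := (one_free_ev (Down r), one_free_ev (Null r)).
have dK : Down r \in events K by rewrite mem_events rK orbT.
have zK : Null r \in events K by rewrite mem_events rK orbT.
apply: absorbed_eql (der_mul (der_refl ofW) defE) _.
have ofdM : one_free (Dot (ev (Down r)) M) by rewrite /= ofM ofd.
have ofzN : one_free (Dot (ev (Null r)) N) by rewrite /= ofN ofz.
apply: absorbed_eql (der_mulDr ofW ofdM ofzN) _.
apply: absorbed_plus.
- apply: absorbed_eql (der_mulA ofW ofd ofM) _.
  have [pos|] := boolP (enabled st (Down r)).
    move: refu; rewrite ifN; last by rewrite -lt0n.
    by apply; apply: tracks_act.
  by move=> stuck; have [_] := tracks_stuck trW dK stuck ofR; apply.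
- apply: absorbed_eql (der_mulA ofW ofz ofN) _.
  have [zero|] := boolP (enabled st (Null r)).
    by move: refu; rewrite [_ == _]zero; apply; apply: (tracks_act trW).
  by move=> stuck; have [_] := tracks_stuck trW zK stuck ofR; apply.
Qed.

Lemma if_unfold r c1 c2 M : one_free M ->
  derivable (Dot (paths (If r c1 c2)) M)
    (Plus (Dot (ev (Down r)) (Dot (paths c1) M))
          (Dot (ev (Null r)) (Dot (paths c2) M))).
Proof.
move=> ofM; have [of1 of2] := (one_free_paths c1, one_free_paths c2).
have [ofd ofz] := (one_free_ev (Down r), one_free_ev (Null r)).
apply: der_trans (der_mulDl _ _ ofM) _; rewrite /= ?of1 ?of2 ?ofd ?ofz //.
exact: der_add (der_sym (der_mulA ofd of1 ofM))
               (der_sym (der_mulA ofz of2 ofM)).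
Qed.

Lemma loop_unfold r c M : one_free M ->
  derivable (Dot (paths (Loop r c)) M)
    (Plus (Dot (ev (Down r)) (Dot (paths c) (Dot (paths (Loop r c)) M)))
          (Dot (ev (Null r)) M)).
Proof.
move=> ofM; have [ofc ofL] := (one_free_paths c, one_free_paths (Loop r c)).
have [ofd ofz] := (one_free_ev (Down r), one_free_ev (Null r)).
have := @der_fix _ (Plus (Dot (shift 0 (ev (Down r)))
  (Dot (shift 0 (paths c)) (Var 0))) (shift 0 (ev (Null r)))) ofL.
rewrite -/(paths (Loop r c)); move: (paths (Loop r c)) ofL => L ofL.
rewrite /= !subst_shiftK => fixL.
apply: der_trans (der_mul fixL (der_refl ofM)) _.
have ofcL : one_free (Dot (paths c) L) by rewrite /= ofc ofL.
have ofdcL : one_free (Dot (ev (Down r)) (Dot (paths c) L)).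
  by rewrite /= ofd ofc ofL.
apply: der_trans (der_mulDl ofdcL ofz ofM) _.
apply: der_add (der_refl _); last by rewrite /= ofz.
apply: der_trans (der_sym (der_mulA ofd ofcL ofM)) _.
exact: der_mul (der_refl ofd) (der_sym (der_mulA ofc ofL ofM)).
Qed.

(** By induction on the execution: as it is finite, finitely many unfoldings of
    the loops of [c] are enough to reach [st'] or a misstep on each path. *)
Lemma refuted_exec K es c st st' : exec c st st' -> regs c <= K ->
  all (@one_free A) es ->
  (forall e, List.In e (subpaths c) -> absorbed e (leftovers es)) ->
  forall M, absorbed M (leftovers es) -> refuted K (leftovers es) st' M ->
  refuted K (leftovers es) st (Dot (paths c) M).
Proof.
move=> ex cK ofes.
have ofR : one_free (leftovers es) by rewrite one_free_leftovers.
move: (leftovers es) (@absorbed_leftovers_dot es) ofR => {es ofes} R Rdot ofR.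
elim: {c st st'} ex cK.
- move=> st _ _ M MR refM W trW.
  apply: absorbed_eql (der_mulA trW.1 (one_free_ev Tick) (absorbed_ofl MR)) _.
  exact/refM/(tracks_act (a := Tick) trW).
- move=> r st rK _ M MR refM W trW.
  apply: absorbed_eql (der_mulA trW.1 (one_free_ev _) (absorbed_ofl MR)) _.
  by apply/refM/(tracks_act (a := Up r) trW); rewrite // mem_events rK orbT.
- move=> c1 c2 st st1 st2 _ IH1 _ IH2 /=; rewrite geq_max => /andP[K1 K2].
  move=> subR M MR refM W trW.
  have [R1 R2] := In_cat_forall (fun e ec => subR e (or_intror ec)).
  have [of1 of2] := (one_free_paths c1, one_free_paths c2).
  apply: absorbed_eql (der_mul (der_refl trW.1)
    (der_sym (der_mulA of1 of2 (absorbed_ofl MR)))) _.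
  have c2R := R2 _ (paths_in_subpaths c2).
  by apply: IH1 trW => //; [exact: Rdot|exact: IH2].
- move=> r c1 c2 st st1 pos _ IH1 /=; rewrite !geq_max => /and3P[rK K1 K2].
  move=> subR M MR refM.
  have [R1 R2] := In_cat_forall (fun e ec => subR e (or_intror ec)).
  have [c1R c2R] := (R1 _ (paths_in_subpaths c1), R2 _ (paths_in_subpaths c2)).
  apply: refuted_branch rK ofR (if_unfold _ _ _ (absorbed_ofl MR)) _ _ _.
  + exact: Rdot.
  + exact: Rdot.
  + by rewrite gtn_eqF //; apply: IH1.
- move=> r c1 c2 st st1 zero _ IH2 /=; rewrite !geq_max => /and3P[rK K1 K2].
  move=> subR M MR refM.
  have [R1 R2] := In_cat_forall (fun e ec => subR e (or_intror ec)).
  have [c1R c2R] := (R1 _ (paths_in_subpaths c1), R2 _ (paths_in_subpaths c2)).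
  apply: refuted_branch rK ofR (if_unfold _ _ _ (absorbed_ofl MR)) _ _ _.
  + exact: Rdot.
  + exact: Rdot.
  + by rewrite zero; apply: IH2.
- move=> r c1 st st1 st2 pos _ IH1 _ IH2 cK subR M MR refM.
  have := cK; rewrite /= geq_max => /andP[rK K1].
  have R1 e ec := subR e (or_intror ec).
  have c1R := R1 _ (paths_in_subpaths c1).
  have LR := subR _ (paths_in_subpaths (Loop r c1)).
  apply: refuted_branch rK ofR (loop_unfold _ _ (absorbed_ofl MR)) _ (MR) _.
  + exact: Rdot c1R (Rdot _ _ LR MR).
  + rewrite gtn_eqF //; apply: IH1 => //; first exact: Rdot.
    exact: IH2.
- move=> r c1 st zero cK subR M MR refM.
  have := cK; rewrite /= geq_max => /andP[rK K1].
  have R1 e ec := subR e (or_intror ec).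
  have c1R := R1 _ (paths_in_subpaths c1).
  have LR := subR _ (paths_in_subpaths (Loop r c1)).
  apply: refuted_branch rK ofR (loop_unfold _ _ (absorbed_ofl MR)) _ (MR) _.
  + exact: Rdot c1R (Rdot _ _ LR MR).
  + by rewrite zero.
Qed.

Definition leftovers_of c : expr A := leftovers (ev (Down 0) :: subpaths c).

Definition faulty c : expr A := faults (regs c).+1 (leftovers_of c).

(** The input [m] is loaded by [m] increments, and the last decrement turns the
    result into a question of violation: at result 0 it is a misstep. *)
Definition runs c (m : nat) : expr A :=
  Dot (ev Tick) (iter m (Dot (ev (Up 0))) (Dot (paths c) (ev (Down 0)))).

Lemma derivable_faulty c m st' : exec c (upd 0 m (fun=> 0)) st' ->
  st' 0 = 0 -> derivable (Plus (faulty c) (runs c m)) (faulty c).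
Proof.
move=> ex halt0; pose K := (regs c).+1; pose es := ev (Down 0) :: subpaths c.
have ofes : all (@one_free A) es by rewrite /= one_free_ev one_free_subpaths.
have ofR : one_free (leftovers es) by rewrite one_free_leftovers.
have upK : Up 0 \in events K by rewrite mem_events.
have dK : Down 0 \in events K by rewrite mem_events.
have refc : refuted K (leftovers es) (upd 0 m (fun=> 0))
              (Dot (paths c) (ev (Down 0))).
  apply: refuted_exec ex _ (ofes) _ _ _ _ => [|e ec||W trW].
  - exact: leqnSn.
  - by apply: absorbed_leftovers (ofes) _; right.
  - by apply: absorbed_leftovers (ofes) _; left.
  - by have [] := tracks_stuck trW dK _ ofR; rewrite //= halt0.
have ofc : one_free (Dot (paths c) (ev (Down 0))).
  by rewrite /= one_free_paths one_free_ev.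
(* Loading the input only adds increments, which are never missteps. *)
suff : forall n st M, upd 0 (st 0 + n) st = upd 0 m (fun=> 0) -> one_free M ->
    refuted K (leftovers es) (upd 0 m (fun=> 0)) M ->
    refuted K (leftovers es) st (iter n (Dot (ev (Up 0))) M).
  move=> /(_ m (fun=> 0) _ _ ofc refc); rewrite add0n => /(_ erefl); apply.
  split=> [|r rK]; first exact: one_free_ev.
  by apply: absorbed_level0; left.
elim=> [|n IH] st M; rewrite ?addn0 => E ofM refM.
  move=> W trW; apply: refM; rewrite -E.
  by rewrite (_ : upd 0 (st 0) st = st) //; apply/funext => -[].
have ofMn : one_free (iter n (Dot (ev (Up 0))) M).
  by elim: (n) => //= k; rewrite one_free_ev.
move=> W trW.
apply: absorbed_eql (der_mulA trW.1 (one_free_ev _) ofMn) _.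
apply: (IH (act st (Up 0))) (tracks_act (a := Up 0) trW upK isT) => //.
by rewrite -E addnS /= /upd eqxx addSn; apply/funext => -[].
Qed.

End Grammar.

(** * Legal words are not faulty *)

Fixpoint legal (st : store) (w : seq event) : bool :=
  if w is a :: w' then enabled st a && legal (act st a) w' else true.

Lemma legal_cat st u v :
  legal st (u ++ v) = legal st u && legal (foldl act st u) v.
Proof. by elim: u st => //= a u IH st; rewrite IH andbA. Qed.

Lemma eq_event :
  (forall r s, (Up r == Up s) = (r == s)) *
  (forall r s, (Down r == Down s) = (r == s)) *
  (forall r s, (Up r == Down s) = false) *
  (forall r s, (Down r == Up s) = false) *
  (forall r s, (Null r == Down s) = false) *
  (forall r s, (Null r == Up s) = false) *
  (forall s, (Tick == Down s) = false) * (forall s, (Tick == Up s) = false).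
Proof.
have inj (f : nat -> event) :
    injective f -> forall r s, (f r == f s) = (r == s).
  by move=> finj r s; apply: inj_eq.
by do !split; do ?[by apply: inj => ? ? []] => *; apply/eqP.
Qed.

Lemma legal_count st w r : legal st w ->
  foldl act st w r + count_mem (Down r) w = st r + count_mem (Up r) w.
Proof.
elim: w st => //= a w IH st /andP[ena /IH].
case: a ena => [|s|s|s] /= ena; rewrite ?eq_event ?add0n //.
- by rewrite /upd [r == s]eq_sym; case: eqP => [->|_] /=; lia.
- by rewrite /upd [r == s]eq_sym; case: eqP ena => [->|_] /=; lia.
Qed.

Section Words.
Variables (A : Type) (a b : A).
Hypothesis ab : a <> b.

Lemma lang_dot (rho : nat -> language A) e f z : lang rho (Dot e f) z ->
  exists x y, [/\ z = x ++ y, lang rho e x & lang rho f y].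
Proof. by move=> [x xe [y yf <-]]; exists x, y. Qed.

Lemma lang_cat (rho : nat -> language A) e f x y :
  lang rho e x -> lang rho f y -> lang rho (Dot e f) (x ++ y).
Proof. by move=> xe yf; exists x => //; exists y. Qed.

(** Unary numerals closed by [b] form a prefix code over two letters. *)
Definition letter (n : nat) : seq A := rcons (nseq n a) b.

Definition spell : nat -> language A := fun n => [set letter n]%classic.

Definition word (w : seq event) : seq A :=
  flatten [seq letter (event_index e) | e <- w].

Lemma word_cat u v : word (u ++ v) = word u ++ word v.
Proof. by rewrite /word map_cat flatten_cat. Qed.

Lemma letter_cat_inj m n x y :
  letter m ++ x = letter n ++ y -> m = n /\ x = y.
Proof.
elim: m n => [|m IH] [|n] /= [].
- by move->.
- by move=> /esym/ab.
- by move=> /ab.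
- by move=> /IH[-> ->].
Qed.

Lemma word_prefix w u y :
  word w = word u ++ y -> exists v, w = u ++ v.
Proof.
elim: u w => [|d u IH] [|e w]; try by exists [::].
- by exists (e :: w).
- by rewrite /word /= /letter; case: (event_index d).
- rewrite /word /= -catA => /letter_cat_inj[/event_index_inj <- /IH[v ->]].
  by exists v.
Qed.

Lemma lang_ev (e : event) : lang spell (ev A e) = [set word [:: e]]%classic.
Proof. by rewrite /word /= cats0. Qed.

Transparent neutrals climb level0 positive.

Lemma lang_neutrals K r x : lang spell (neutrals A K r) x ->
  exists2 e, neutral r e & x = word [:: e].
Proof.
move=> /lang_alt[f].
elim: (events K) => //= e es IH; case: ifP => [re|_ /IH//] /= [<-|/IH//].
by rewrite lang_ev => ->; exists e.
Qed.

(* Balanced words *)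
(** The invariant for the grammar of the levels. It only compares total
    numbers of events, which is enough for a bound from above: on a legal word
    the difference of these numbers is the content of the register. *)
Definition net (r k : nat) : language A :=
  [set word w | w in
    [set w | count_mem (Up r) w = count_mem (Down r) w + k]]%classic.

Lemma net_neutral r k x y : net r k x ->
  (exists2 e, neutral r e & y = word [:: e]) -> net r k (x ++ y).
Proof.
move=> [u uk <-] [e re ->]; exists (u ++ [:: e]); last by rewrite word_cat.
move: re uk; rewrite /= !count_cat /= /neutral => /andP[/negbTE-> /negbTE->].
by rewrite !addn0.
Qed.

Lemma net_cat r j k x y : net r j x -> net r k y -> net r (j + k) (x ++ y).
Proof.
move=> [u uk <-] [v vk <-]; exists (u ++ v); last by rewrite word_cat.
by rewrite /= !count_cat uk vk addnACA.
Qed.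

Lemma net_down r k x y : net r k.+1 x -> lang spell (ev A (Down r)) y ->
  net r k (x ++ y).
Proof.
rewrite lang_ev => -[u uk <-] ->; exists (u ++ [:: Down r]).
  by rewrite /= !count_cat uk /= !eq_event eqxx !addn0 -addnA add1n.
by rewrite word_cat.
Qed.

Lemma lang_climb K r : (lang spell (climb A K r) `<=` net r 1)%classic.
Proof.
apply: lang_choice => e [<-|[<-|[<-|//]]].
- rewrite lang_shift lang_ev => x ->; exists [:: Up r] => //=.
  by rewrite !eq_event eqxx.
- move=> _ /lang_dot[x [y [-> xB yN]]]; rewrite lang_shift in yN.
  exact: net_neutral xB (lang_neutrals yN).
- move=> _ /lang_dot[_ [z [-> /lang_dot[x [y [-> xB yB]]] zD]]].
  rewrite lang_shift in zD.
  exact: net_down (net_cat xB yB) zD.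
Qed.

Lemma lang_level0 K r : (lang spell (level0 A K r) `<=` net r 0)%classic.
Proof.
apply: lang_choice => e [<-|[<-|[<-|//]]].
- by rewrite lang_shift lang_ev => x ->; exists [:: Tick].
- move=> _ /lang_dot[x [y [-> xB yN]]]; rewrite lang_shift in yN.
  exact: net_neutral xB (lang_neutrals yN).
- move=> _ /lang_dot[_ [z [-> /lang_dot[x [y [-> xB yX]]] zD]]].
  rewrite lang_shift in zD.
  rewrite lang_shift in yX.
  exact: net_down (net_cat xB (lang_climb yX)) zD.
Qed.

Lemma lang_positive K r x :
  lang spell (positive A K r) x -> exists k, net r k.+1 x.
Proof.
move: x; apply: (@lang_choice _ _ _ [set x | exists k, net r k.+1 x]%classic).
move=> e [<-|[<-|//]].
- move=> _ /lang_dot[x [y [-> xL yX]]]; rewrite !lang_shift in xL yX.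
  exists 0; exact: net_cat (lang_level0 xL) (lang_climb yX).
- move=> _ /lang_dot[x [y [-> [k xk] yX]]]; rewrite lang_shift in yX.
  exists k.+1; rewrite -addn1; exact: net_cat xk (lang_climb yX).
Qed.

(** Nothing is known about the words of [R], so the conclusion speaks of a
    prefix; legality is inherited by prefixes. *)
Lemma lang_faults K R x : lang spell (faults K R) x ->
  exists u e y, [/\ x = word (rcons u e) ++ y &
    forall st, st =1 (fun=> 0) -> ~~ legal st (rcons u e)].
Proof.
move=> /lang_alt[f]; elim: (iota 0 K) => //= r s IH [<-|/IH//].
move=> /(@lang_alt _ _ (misstep K r R))[g].
have down u y : net r 0 u -> lang spell (ev A (Down r)) y -> exists w,
    u ++ y = word (rcons w (Down r)) /\
    forall st, st =1 (fun=> 0) -> ~~ legal st (rcons w (Down r)).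
  rewrite lang_ev => -[w wk <-] ->; exists w.
  rewrite -cats1 word_cat; split=> // st st0.
  rewrite legal_cat; apply/negP=> /andP[/legal_count - /(_ r)] /=.
  move: wk; rewrite /= st0 => ->; lia.
have null u y : (exists k, net r k.+1 u) -> lang spell (ev A (Null r)) y ->
    exists w, u ++ y = word (rcons w (Null r)) /\
    forall st, st =1 (fun=> 0) -> ~~ legal st (rcons w (Null r)).
  rewrite lang_ev => -[k [w wk <-]] ->; exists w.
  rewrite -cats1 word_cat; split=> // st st0.
  rewrite legal_cat; apply/negP=> /andP[/legal_count - /(_ r)] /=.
  move: wk; rewrite /= st0 => ->; lia.
case=> [<-|[<-|[<-|[<-|//]]]].
- move=> /lang_dot[u [y [-> /lang_level0 uL yD]]].
  have [w [-> bad]] := down u y uL yD.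
  by exists w, (Down r), [::]; rewrite cats0.
- move=> /lang_dot[_ [z [-> /lang_dot[u [y [-> /lang_level0 uL yD]]] _]]].
  have [w [-> bad]] := down u y uL yD.
  by exists w, (Down r), z.
- move=> /lang_dot[u [y [-> /lang_positive uL yD]]].
  have [w [-> bad]] := null u y uL yD.
  by exists w, (Null r), [::]; rewrite cats0.
- move=> /lang_dot[_ [z [-> /lang_dot[u [y [-> /lang_positive uL yD]]] _]]].
  have [w [-> bad]] := null u y uL yD.
  by exists w, (Null r), z.
Qed.

Lemma lang_ev_dot e M w : lang spell M (word w) ->
  lang spell (Dot (ev A e) M) (word (e :: w)).
Proof.
move=> wM; exists (word [:: e]); first by rewrite lang_ev.
by exists (word w) => //; rewrite -word_cat.
Qed.

Lemma exec_word c st st' : exec c st st' ->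
  exists w, [/\ lang spell (paths A c) (word w), legal st w
    & foldl act st w = st'].
Proof.
have cat_dot M N u v : lang spell M (word u) -> lang spell N (word v) ->
    lang spell (Dot M N) (word (u ++ v)).
  by move=> uM vN; exists (word u) => //; exists (word v); rewrite ?word_cat.
elim=> {c st st'}.
- by move=> st; exists [:: Tick]; split=> //; rewrite [paths _ _]/= lang_ev.
- by move=> r st; exists [:: Up r]; split=> //; rewrite [paths _ _]/= lang_ev.
- move=> c1 c2 st st1 st2 _ [u [uL uleg <-]] _ [v [vL vleg <-]].
  exists (u ++ v); rewrite legal_cat uleg foldl_cat; split=> //.
  exact: cat_dot.
- move=> r c1 c2 st st1 pos _ [u [uL uleg <-]].
  exists (Down r :: u); split=> //; last by rewrite /= pos uleg.
  by left; apply: (lang_ev_dot _ uL).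
- move=> r c1 c2 st st1 zero _ [u [uL uleg <-]].
  exists (Null r :: u); split=> //; last by rewrite /= zero uleg.
  by right; apply: (lang_ev_dot _ uL).
- move=> r c st st1 st2 pos _ [u [uL uleg <-]] _ [v [vL vleg <-]].
  exists (Down r :: u ++ v); split; last by rewrite /= foldl_cat.
    move=> B closedB; apply: (closedB); left.
    rewrite -cat1s !word_cat; apply: lang_cat; first
      by rewrite lang_shift lang_ev.
    by apply: lang_cat; [rewrite lang_shift|exact: (vL B closedB)].
  by rewrite /= legal_cat pos uleg.
- move=> r c st zero; exists [:: Null r]; split=> //; last by rewrite /= zero.
  by move=> B closedB; apply: (closedB); right; rewrite lang_shift lang_ev.
Qed.

Lemma not_valid_faulty c m st' : exec c (upd 0 m (fun=> 0)) st' ->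
  0 < st' 0 -> ~ valid (Plus (faulty A c) (runs A c m)) (faulty A c).
Proof.
move=> /exec_word[w [wL wleg <-]] halt1 /(_ spell) eqL.
pose u := Tick :: nseq m (Up 0) ++ w ++ [:: Down 0].
have upm n st : foldl act st (nseq n (Up 0)) = upd 0 (st 0 + n) st.
  elim: n st => [|n IH] st /=; first by apply/funext => -[|//]; rewrite addn0.
  by rewrite IH; apply/funext => -[|//]; rewrite /= /upd eqxx addnS addSn.
have uplegal n st : legal st (nseq n (Up 0)) by elim: n st => //= n IH st.
have uleg : legal (fun=> 0) u.
  by rewrite /u /= !legal_cat uplegal upm wleg /= halt1.
have uF : lang spell (runs A c m) (word u).
  apply: lang_ev_dot; elim: (m) => [|n IH]; last exact: lang_ev_dot.
  exists (word w) => //; exists (word [:: Down 0]); last by rewrite -word_cat.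
  by rewrite lang_ev.
have : lang spell (faulty A c) (word u) by rewrite -eqL; right.
move=> /lang_faults[v [e [y [/word_prefix[z uE] bad]]]].
have := bad (fun=> 0) (fun=> erefl).
by move: uleg; rewrite uE legal_cat => /andP[->].
Qed.

End Words.

(** * Counter programs for partial recursive functions *)

(** Trailing zeros are immaterial, so unused registers need not be listed. *)
Definition memory (l : seq nat) : store := nth 0 l.

(** Runs [c] above a register that it leaves alone. All programs below take
    their input in register 0 and leave only their result there, hence lifting
    is all that calling a subprogram requires. *)
Fixpoint lift (c : cmd) : cmd :=
  match c with
  | Skip => Skip
  | Inc r => Inc r.+1
  | Seq c1 c2 => Seq (lift c1) (lift c2)
  | If r c1 c2 => If r.+1 (lift c1) (lift c2)
  | Loop r c1 => Loop r.+1 (lift c1)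
  end.

Lemma exec_lift c l l' x :
  exec c (memory l) (memory l') ->
  exec (lift c) (memory (x :: l)) (memory (x :: l')).
Proof.
pose env (st : store) : store := fun r => if r is r'.+1 then st r' else x.
have memE m : memory (x :: m) = env (memory m) by apply/funext => -[].
rewrite !memE; elim=> {c l l'} /=.
- by move=> st; apply: exec_skip.
- move=> r st; rewrite -[X in exec _ _ X](_ : act (env st) (Up r.+1) = _).
    exact: exec_inc.
  by apply/funext => -[].
- by move=> c1 c2 st st1 st2 _ IH1 _ IH2; apply: exec_seq IH1 IH2.
- move=> r c1 c2 st st1 pos _ IH; apply: exec_if_pos => //.
  by rewrite (_ : act _ _ = env (act st (Down r))) //; apply/funext => -[].
- by move=> r c1 c2 st st1 zero _ IH; apply: exec_if_zero.
- move=> r c st st1 st2 pos _ IH1 _; apply: exec_loop_pos => //.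
  by rewrite (_ : act _ _ = env (act st (Down r))) //; apply/funext => -[].
- by move=> r c st zero; apply: exec_loop_zero.
Qed.

Definition reset r := Loop r Skip.

Definition transfer r s := Loop r (Inc s).

Definition copy r s t := Seq (Loop r (Seq (Inc s) (Inc t))) (transfer t r).

Ltac store_eq :=
  apply/funext => ?; rewrite /act /upd; do ?[case: eqP => ?]; subst => //=; lia.

Lemma exec_reset r st : exec (reset r) st (upd r 0 st).
Proof.
move: {2}(st r) (erefl (st r)) => n; elim: n st => [|n IH] st str.
  rewrite (_ : upd r 0 st = st); first exact: exec_loop_zero.
  store_eq.
rewrite (_ : upd r 0 st = upd r 0 (act st (Down r))); last by store_eq.
apply: exec_loop_pos (exec_skip _) (IH _ _); first by rewrite str.
by rewrite /= /upd eqxx str.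
Qed.

Lemma exec_transfer r s st : r <> s ->
  exec (transfer r s) st (upd r 0 (upd s (st s + st r) st)).
Proof.
move=> rs; move: {2}(st r) (erefl (st r)) => n.
elim: n st => [|n IH] st str.
  rewrite (_ : upd r 0 _ = st); first exact: exec_loop_zero.
  store_eq.
rewrite (_ : upd r 0 _ = let st' := act (act st (Down r)) (Up s) in
  upd r 0 (upd s (st' s + st' r) st')); last by store_eq.
apply: exec_loop_pos (exec_inc _ _) (IH _ _); first by rewrite str.
by rewrite /= /upd; do ?[case: eqP => ?]; subst => //; lia.
Qed.

Lemma exec_transfer2 r s t st : r <> s -> r <> t -> s <> t ->
  exec (Loop r (Seq (Inc s) (Inc t))) st
    (upd r 0 (upd s (st s + st r) (upd t (st t + st r) st))).
Proof.
move=> rs rt s_t; move: {2}(st r) (erefl (st r)) => n.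
elim: n st => [|n IH] st str.
  rewrite (_ : upd r 0 _ = st); first exact: exec_loop_zero.
  store_eq.
rewrite (_ : upd r 0 _ = let st' := act (act (act st (Down r)) (Up s)) (Up t) in
  upd r 0 (upd s (st' s + st' r) (upd t (st' t + st' r) st')));
  last by store_eq.
apply: exec_loop_pos (exec_seq (exec_inc _ _) (exec_inc _ _)) (IH _ _).
  by rewrite str.
by rewrite /= /upd; do ?[case: eqP => ?]; subst => //; lia.
Qed.

Lemma exec_copy r s t st : r <> s -> r <> t -> s <> t -> st t = 0 ->
  exec (copy r s t) st (upd s (st s + st r) st).
Proof.
move=> rs rt s_t t0; apply: exec_seq (exec_transfer2 _ rs rt s_t) _.
rewrite [X in exec _ _ X](_ : _ = let st' :=
  upd r 0 (upd s (st s + st r) (upd t (st t + st r) st)) in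
  upd t 0 (upd r (st' r + st' t) st')); first by apply: exec_transfer => /esym.
store_eq.
Qed.

Ltac mem_eq :=
  apply/funext; rewrite /act /upd /memory;
  do 8?[case; first by rewrite /= ?addn0 ?add0n ?addn1];
  by case=> [|?]; rewrite /= ?nth_nil.

Lemma exec_via c1 c2 l l1 st st2 :
  exec c1 (memory l) st -> st = memory l1 -> exec c2 (memory l1) st2 ->
  exec (Seq c1 c2) (memory l) st2.
Proof. by move=> + stE; rewrite stE; apply: exec_seq. Qed.

Lemma exec_to c l st l' : exec c (memory l) st -> st = memory l' ->
  exec c (memory l) (memory l').
Proof. by move=> ex <-. Qed.

Definition swap := Seq (transfer 0 2) (Seq (transfer 1 0) (transfer 2 1)).

Lemma exec_swap x y : exec swap (memory [:: x; y]) (memory [:: y; x]).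
Proof.
apply: (exec_via (l1 := [:: 0; y; x])); [exact: exec_transfer|mem_eq|].
apply: (exec_via (l1 := [:: y; 0; x])); [exact: exec_transfer|mem_eq|].
by apply: exec_to; [exact: exec_transfer|mem_eq].
Qed.

(** Follows the enumeration of pairs by [Cantor.of_nat]: each step moves one
    place along a diagonal or on to the start of the next one. *)
Definition unpack :=
  Seq (Loop 0 (If 1 (Inc 2) (Seq (transfer 2 1) (Inc 1))))
      (Seq (transfer 1 0) (transfer 2 1)).

Lemma exec_unpack x :
  exec unpack (memory [:: x]) (memory [:: (of_nat x).1; (of_nat x).2]).
Proof.
apply: (exec_via (l1 := [:: 0; (of_nat x).1; (of_nat x).2])); last first.
- apply: (exec_via (l1 := [:: (of_nat x).1; 0; (of_nat x).2])).
  + exact: exec_transfer.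
  + mem_eq.
  + by apply: exec_to; [exact: exec_transfer|mem_eq].
- by [].
suff loop k j : exec (Loop 0 (If 1 (Inc 2) (Seq (transfer 2 1) (Inc 1))))
    (memory [:: k; (of_nat j).1; (of_nat j).2])
    (memory [:: 0; (of_nat (j + k)).1; (of_nat (j + k)).2]).
  have := loop x 0.
  by rewrite (_ : memory [:: x; _; _] = memory [:: x]) //; mem_eq.
elim: k j => [|k IH] j; first by rewrite addn0; apply: exec_loop_zero.
rewrite addnS -addSn; apply: exec_loop_pos (IH j.+1) => //.
rewrite (_ : act _ _ = memory [:: k; (of_nat j).1; (of_nat j).2]);
  last by mem_eq.
rewrite (_ : of_nat j.+1 = let '(p, q) := of_nat j in
  if p is p'.+1 then (p', q.+1) else (q.+1, 0)) //.
case: (of_nat j) => -[|p] q /=.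
- apply: exec_if_zero => //.
  apply: (exec_via (l1 := [:: k; q; 0])); [exact: exec_transfer|mem_eq|].
  by apply: exec_to; [exact: exec_inc|mem_eq].
- apply: exec_if_pos => //.
  rewrite (_ : act _ _ = memory [:: k; p; q]); last by mem_eq.
  by apply: exec_to; [exact: exec_inc|mem_eq].
Qed.

(** [Cantor.to_nat] adds y to the triangular number of x + y: one loop forms the
    sum x + y while it saves y, the second adds up the triangular number. *)
Definition pack := Seq (Loop 1 (Seq (Inc 0) (Inc 2)))
  (Seq (Loop 0 (Seq (copy 0 2 1) (Inc 2))) (transfer 2 0)).

Lemma exec_pack x y : exec pack (memory [:: x; y]) (memory [:: cpair x y]).
Proof.
apply: (exec_via (l1 := [:: y + x; 0; y])); [exact: exec_transfer2| |].
  by rewrite addnC; mem_eq.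
apply: (exec_via (l1 := [:: 0; 0; cpair x y])) => //; last first.
  by apply: exec_to; [exact: exec_transfer|mem_eq].
rewrite /cpair /to_nat !plusE; move: (y + x) => k.
elim: k y => [|k IH] y /=; first by rewrite addn0; apply: exec_loop_zero.
rewrite addnA.
apply: exec_loop_pos (IH _) => //.
rewrite (_ : act _ _ = memory [:: k; 0; y]); last by mem_eq.
apply: (exec_via (l1 := [:: k; 0; y + k])); [exact: exec_copy|mem_eq|].
by apply: exec_to; [exact: exec_inc|rewrite addnS; mem_eq].
Qed.

(** Registers: 0 counts the remaining rounds, 1 holds the parameter, 2 the
    number of the round, and 3 the current value, where the argument of [g] is
    then built. *)
Definition prec_body (g : cmd) : cmd :=
  Seq (transfer 3 5) (Seq (copy 1 3 6) (Seq (copy 2 4 6)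
  (Seq (iter 4 lift pack) (Seq (iter 3 lift pack)
  (Seq (iter 3 lift g) (Inc 2)))))).

(** Registers: 0 tells whether to go on, 1 holds the input, 2 the candidate, and
    3 the value of [f] at the candidate. *)
Definition min_body (f : cmd) : cmd :=
  Seq (copy 1 3 5) (Seq (copy 2 4 5) (Seq (iter 3 lift pack)
  (Seq (iter 3 lift f)
  (If 3 (Seq (reset 3) (Seq (Inc 2) (Inc 0))) Skip)))).

Fixpoint compile (f : recfun) : cmd :=
  match f with
  | RZero => reset 0
  | RSucc => Inc 0
  | RFst => Seq unpack (reset 1)
  | RSnd => Seq unpack (Seq (reset 0) (transfer 1 0))
  | RPair f g =>
      Seq (copy 0 1 2) (Seq (lift (compile g)) (Seq swap
      (Seq (lift (compile f)) (Seq swap pack))))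
  | RComp f g => Seq (compile g) (compile f)
  | RPrec f g =>
      Seq unpack (Seq swap (Seq (copy 1 3 4) (Seq (iter 3 lift (compile f))
      (Seq (Loop 0 (prec_body (compile g)))
      (Seq (reset 1) (Seq (reset 2) (transfer 3 0)))))))
  | RMin f =>
      Seq (transfer 0 1) (Seq (Inc 0) (Seq (Loop 0 (min_body (compile f)))
      (Seq (reset 1) (transfer 2 0))))
  end.

Lemma exec_prec_body g k a m z y :
  exec g (memory [:: cpair a (cpair m z)]) (memory [:: y]) ->
  exec (prec_body g) (memory [:: k; a; m; z]) (memory [:: k; a; m.+1; y]).
Proof.
move=> exg.
apply: (exec_via (l1 := [:: k; a; m; 0; 0; z])); [exact: exec_transfer|mem_eq|].
apply: (exec_via (l1 := [:: k; a; m; a; 0; z])); [exact: exec_copy|mem_eq|].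
apply: (exec_via (l1 := [:: k; a; m; a; m; z])); [exact: exec_copy|mem_eq|].
apply: (exec_via (l1 := [:: k; a; m; a; cpair m z])) => //.
  by do 4![apply: exec_lift]; apply: exec_pack.
apply: (exec_via (l1 := [:: k; a; m; cpair a (cpair m z)])) => //.
  by do 3![apply: exec_lift]; apply: exec_pack.
apply: (exec_via (l1 := [:: k; a; m; y])) => //.
  by do 3![apply: exec_lift].
by apply: exec_to; [exact: exec_inc|mem_eq].
Qed.

(** The recursion descends from [n] while the program ascends to [n], so the
    induction carries the rest of the execution along. *)
Lemma exec_prec_loop (g : recfun) c a n (F : nat -> nat -> Prop) z :
  (forall x y, eval g x y -> exec c (memory [:: x]) (memory [:: y])) ->
  prec_graph F (eval g) a n z ->
  exists2 z0, F a z0 & exec (Loop 0 (prec_body c))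
    (memory [:: n; a; 0; z0]) (memory [:: 0; a; n; z]).
Proof.
move=> exg; suff loop k st : prec_graph F (eval g) a n z ->
    exec (Loop 0 (prec_body c)) (memory [:: k; a; n; z]) st ->
    exists2 z0, F a z0 &
      exec (Loop 0 (prec_body c)) (memory [:: n + k; a; 0; z0]) st.
  by move/(loop 0); rewrite addn0; apply; apply: exec_loop_zero.
elim: n k z => [|n IH] k z /=; first by exists z.
move=> [z' [z'F zG]] exk; rewrite addSnnS; apply: IH z'F _.
apply: exec_loop_pos exk => //.
rewrite (_ : act _ _ = memory [:: k; a; n; z']); last by mem_eq.
exact/exec_prec_body/exg.
Qed.

Lemma exec_min_loop (f : recfun) c x y :
  (forall u v, eval f u v -> exec c (memory [:: u]) (memory [:: v])) ->
  eval (RMin f) x y ->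
  exec (Loop 0 (min_body c)) (memory [:: 1; x]) (memory [:: 0; x; y]).
Proof.
move=> exf [f0 fS].
have body m w st : eval f (cpair x m) w ->
    exec (If 3 (Seq (reset 3) (Seq (Inc 2) (Inc 0))) Skip)
      (memory [:: 0; x; m; w]) st ->
    exec (min_body c) (act (memory [:: 1; x; m]) (Down 0)) st.
  move=> /exf exw exif.
  rewrite (_ : act _ _ = memory [:: 0; x; m]); last by mem_eq.
  apply: (exec_via (l1 := [:: 0; x; m; x])); [exact: exec_copy|mem_eq|].
  apply: (exec_via (l1 := [:: 0; x; m; x; m])); [exact: exec_copy|mem_eq|].
  apply: (exec_via (l1 := [:: 0; x; m; cpair x m])) => //.
    by do 3![apply: exec_lift]; apply: exec_pack.
  apply: (exec_via (l1 := [:: 0; x; m; w])) exif => //.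
  by do 3![apply: exec_lift].
suff loop k : k <= y -> exec (Loop 0 (min_body c))
    (memory [:: 1; x; y - k]) (memory [:: 0; x; y]).
  have := loop y (leqnn y); rewrite subnn.
  by rewrite (_ : memory [:: 1; x; 0] = memory [:: 1; x]) //; mem_eq.
elim: k => [|k IH] ky.
  rewrite subn0.
  apply: exec_loop_pos (body _ _ _ f0 _) (exec_loop_zero _ _) => //.
  rewrite (_ : memory [:: 0; x; y; 0] = memory [:: 0; x; y]); last by mem_eq.
  by apply: exec_if_zero => //; apply: exec_skip.
have [w fw] := fS (y - k.+1) ltac:(lia).
apply: exec_loop_pos (body _ _ _ fw _) (IH (ltnW ky)) => //.
apply: exec_if_pos => //.
rewrite (_ : act _ _ = memory [:: 0; x; y - k.+1; w]); last by mem_eq.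
apply: (exec_via (l1 := [:: 0; x; y - k.+1])); [exact: exec_reset|mem_eq|].
apply: (exec_via (l1 := [:: 0; x; y - k])); [exact: exec_inc| |].
  by rewrite -[y - k]prednK ?subn_gt0 // -subnS; mem_eq.
by apply: exec_to; [exact: exec_inc|mem_eq].
Qed.

Lemma exec_compile f x y :
  eval f x y -> exec (compile f) (memory [:: x]) (memory [:: y]).
Proof.
elim: f x y => [||||f IHf g IHg|f IHf g IHg|f IHf g IHg|f IHf] x y.
- by move->; apply: exec_to; [exact: exec_reset|mem_eq].
- by move->; apply: exec_to; [exact: exec_inc|mem_eq].
- move->; apply: exec_via (exec_unpack x) (erefl _) _.
  by apply: exec_to; [exact: exec_reset|mem_eq].
- move->; apply: exec_via (exec_unpack x) (erefl _) _.
  apply: (exec_via (l1 := [:: 0; (of_nat x).2])); [exact: exec_reset|mem_eq|].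
  by apply: exec_to; [exact: exec_transfer|mem_eq].
- move=> [u [v [fu gv ->]]].
  apply: (exec_via (l1 := [:: x; x])); [exact: exec_copy|mem_eq|].
  apply: (exec_via (exec_lift _ (IHg _ _ gv)) (erefl _)).
  apply: (exec_via (exec_swap _ _) (erefl _)).
  apply: (exec_via (exec_lift _ (IHf _ _ fu)) (erefl _)).
  apply: (exec_via (exec_swap _ _) (erefl _)).
  exact: exec_pack.
- by move=> [z [gz fy]]; apply: exec_seq (IHg _ _ gz) (IHf _ _ fy).
- move=> /= pry; have [z0 fz0 loop] := exec_prec_loop IHg pry.
  apply: exec_via (exec_unpack x) (erefl _) _; move: fz0 loop {pry}.
  move: (of_nat x).1 (of_nat x).2 => a n fz0 loop.
  apply: exec_via (exec_swap _ _) (erefl _) _.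
  apply: (exec_via (l1 := [:: n; a; 0; a])); [exact: exec_copy|mem_eq|].
  apply: (exec_via (l1 := [:: n; a; 0; z0])) => //.
    by do 3![apply: exec_lift]; apply: IHf.
  apply: (exec_via loop (erefl _)).
  apply: (exec_via (l1 := [:: 0; 0; n; y])); [exact: exec_reset|mem_eq|].
  apply: (exec_via (l1 := [:: 0; 0; 0; y])); [exact: exec_reset|mem_eq|].
  by apply: exec_to; [exact: exec_transfer|mem_eq].
- move=> fmin.
  apply: (exec_via (l1 := [:: 0; x])); [exact: exec_transfer|mem_eq|].
  apply: (exec_via (l1 := [:: 1; x])); [exact: exec_inc|mem_eq|].
  apply: (exec_via (exec_min_loop IHf fmin) (erefl _)).
  apply: (exec_via (l1 := [:: 0; 0; y])); [exact: exec_reset|mem_eq|].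
  by apply: exec_to; [exact: exec_transfer|mem_eq].
Qed.

(** * Computable functions and step-bounded evaluation *)

Definition fst_of (x : nat) : nat := (of_nat x).1.
Definition snd_of (x : nat) : nat := (of_nat x).2.

Lemma fst_cpair x y : fst_of (cpair x y) = x.
Proof. by rewrite /fst_of /cpair cancel_of_to. Qed.

Lemma snd_cpair x y : snd_of (cpair x y) = y.
Proof. by rewrite /snd_of /cpair cancel_of_to. Qed.

Lemma cpair_of x : cpair (fst_of x) (snd_of x) = x.
Proof. by rewrite /cpair -[RHS]cancel_to_of -surjective_pairing. Qed.

Lemma cpair_inj x y x' y' : cpair x y = cpair x' y' -> x = x' /\ y = y'.
Proof. by move/to_nat_inj => -[-> ->]. Qed.

Lemma computable_comp f g :
  computable f -> computable g -> computable (fun x => f (g x)).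
Proof. by move=> [cf Hf] [cg Hg]; exists (RComp cf cg) => x; exists (g x). Qed.

Lemma computable_pair f g :
  computable f -> computable g -> computable (fun x => cpair (f x) (g x)).
Proof.
by move=> [cf Hf] [cg Hg]; exists (RPair cf cg) => x; exists (f x), (g x).
Qed.

Lemma computable_fst : computable fst_of.
Proof. by exists RFst. Qed.

Lemma computable_snd : computable snd_of.
Proof. by exists RSnd. Qed.

Lemma computable_succ f : computable f -> computable (fun x => (f x).+1).
Proof. by apply: (@computable_comp S); exists RSucc. Qed.

Lemma computable_id : computable id.
Proof.
have [c Hc] := computable_pair computable_fst computable_snd.
by exists c => x; have := Hc x; rewrite cpair_of.
Qed.

Lemma computable_const n : computable (fun=> n).
Proof. by elim: n => [|n IH]; [exists RZero|apply: computable_succ IH]. Qed.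

Definition computable2 (f : nat -> nat -> nat) : Prop :=
  computable (fun x => f (fst_of x) (snd_of x)).

Lemma computable_comp2 h f g : computable2 h -> computable f -> computable g ->
  computable (fun x => h (f x) (g x)).
Proof.
move=> ch cf cg; have [c Hc] := computable_comp ch (computable_pair cf cg).
by exists c => x; have := Hc x; rewrite fst_cpair snd_cpair.
Qed.

Lemma computable_rec f n (h : nat -> nat -> nat -> nat) :
  computable f -> computable n ->
  computable2 (fun x q => h x (fst_of q) (snd_of q)) ->
  computable (fun x => nat_rec (fun=> nat) (f x) (h x) (n x)).
Proof.
move=> [cf Hf] cn [ch Hh].
suff rec2 : computable2 (fun x m => nat_rec (fun=> nat) (f x) (h x) m).
  exact: computable_comp2 rec2 computable_id cn.
exists (RPrec cf ch) => x; rewrite /= -/(fst_of x) -/(snd_of x).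
elim: (snd_of x) => [|m IH] /=; first exact: Hf.
exists (nat_rec (fun=> nat) (f (fst_of x)) (h (fst_of x)) m); split=> //.
by have := Hh (cpair (fst_of x) (cpair m (nat_rec (fun=> nat) (f (fst_of x))
  (h (fst_of x)) m))); rewrite !(fst_cpair, snd_cpair).
Qed.

(** A primitive recursion that ignores its previous values. *)
Lemma computable_case n f (g : nat -> nat -> nat) :
  computable n -> computable f -> computable2 g ->
  computable (fun x => if n x is m.+1 then g x m else f x).
Proof.
move=> cn cf cg.
have := @computable_rec f n (fun x m _ => g x m) cf cn _.
have cgm : computable2 (fun x q => g x (fst_of q)).
  apply: computable_comp2 cg computable_fst _.
  exact: computable_comp computable_fst computable_snd.
move=> /(_ cgm) [c Hc]; exists c => x; have := Hc x.
by case: (n x).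
Qed.

(** Evaluation that searches each minimization up to [k] only, hence total: 0
    means no value, and y + 1 the value y. In the search, 0 means that all
    candidates so far had a positive value, 1 that one of them had none, and
    m + 2 that [m] is the answer. *)
Fixpoint bounded_eval (c : recfun) (k x : nat) : nat :=
  match c with
  | RZero => 1
  | RSucc => x.+2
  | RFst => (fst_of x).+1
  | RSnd => (snd_of x).+1
  | RPair f g =>
      if bounded_eval f k x is u.+1 then
        if bounded_eval g k x is v.+1 then (cpair u v).+1 else 0
      else 0
  | RComp f g => if bounded_eval g k x is z.+1 then bounded_eval f k z else 0
  | RPrec f g =>
      nat_rec (fun=> nat) (bounded_eval f k (fst_of x))
        (fun m r =>
           if r is z.+1 then bounded_eval g k (cpair (fst_of x) (cpair m z))
           else 0) (snd_of x)
  | RMin f =>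
      (nat_rec (fun=> nat) 0
        (fun m r => if r is r'.+1 then r'.+1
                    else if bounded_eval f k (cpair x m) is v.+1 then
                           if v is _.+1 then 0 else m.+2
                         else 1) k).-1
  end.

Lemma computable_bounded_eval c : computable2 (bounded_eval c).
Proof.
have [F S I] := And3 computable_fst computable_snd computable_id.
have FF := computable_comp F F; have SF := computable_comp S F.
have FS := computable_comp F S; have SS := computable_comp S S.
have at2 d a b : computable2 (bounded_eval d) -> computable a -> computable b ->
    computable (fun x => bounded_eval d (a x) (b x)).
  exact: computable_comp2.
have cst := computable_const.
elim: c => [||||f IHf g IHg|f IHf g IHg|f IHf g IHg|f IHf];
  rewrite /computable2 /=.
- exact: cst.
- exact/computable_succ/computable_succ.
- exact: computable_succ FS.
- exact: computable_succ SS.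
- apply: (computable_case IHf (cst 0)).
  apply: (computable_case (at2 _ _ _ IHg FF SF) (cst 0)).
  exact: computable_succ (computable_pair SF S).
- apply: (computable_case IHg (cst 0)).
  exact: at2 IHf FF S.
- apply: (computable_rec (at2 _ _ _ IHf F FS) SS).
  apply: (computable_case SS (cst 0)).
  apply: at2 IHg (computable_comp FF F) _.
  apply: computable_pair (computable_comp FS FF) (computable_pair _ S).
  exact: computable_comp FS F.
- apply: (@computable_comp predn).
    have [c Hc] := @computable_case id (fun=> 0) (fun _ m => m) I (cst 0) S.
    by exists c => x; have := Hc x; case: x.
  apply: (computable_rec (cst 0) F).
  apply: (computable_case SS) (computable_succ S).
  have cm : computable (fun x => fst_of (snd_of x)) by [].
  apply: (computable_case (at2 _ _ _ IHf FF (computable_pair SF FS)) (cst 1)).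
  apply: (computable_case S) (cst 0).
  apply/computable_succ/computable_succ.
  exact: computable_comp FS F.
Qed.

Lemma bounded_eval_sound c k x y : bounded_eval c k x = y.+1 -> eval c x y.
Proof.
elim: c x y => [||||f IHf g IHg|f IHf g IHg|f IHf g IHg|f IHf] x y /=.
- by case.
- by case.
- by case.
- by case.
- case Ef: (bounded_eval f k x) => [//|u].
  case Eg: (bounded_eval g k x) => [//|v] [<-].
  by exists u, v; split=> //; [apply: IHf|apply: IHg].
- case Eg: (bounded_eval g k x) => [//|z] Ef.
  by exists z; split; [apply: IHg|apply: IHf].
- rewrite -/(fst_of x) -/(snd_of x); elim: (snd_of x) y => [|m IH] y /=.
    exact: IHf.
  set r := nat_rec _ _ _ _ in IH *; case Er: r => [//|z] Eg.
  by exists z; split; [apply: IH|apply: IHg].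
- set s := nat_rec _ _ _.
  have searchP j : match s j with
      | 0 => forall m, m < j -> exists v, eval f (cpair x m) v.+1
      | 1 => True
      | z.+2 => eval (RMin f) x z
      end.
    elim: j => [//|j]; rewrite [s j.+1]/=; case: (s j) => [small|[|z]] //.
    case Ef: (bounded_eval f k (cpair x j)) => [//|[|v]].
      by split; [apply: IHf|].
    move=> m; rewrite ltnS leq_eqVlt => /orP[/eqP->|/small//].
    by exists v; apply: IHf.
  have := searchP k; case: (s k) => [|[|z]] //= H [<-]; exact: H.
Qed.

Lemma bounded_eval_complete c x y :
  eval c x y -> exists k0, forall k, k0 <= k -> bounded_eval c k x = y.+1.
Proof.
elim: c x y => [||||f IHf g IHg|f IHf g IHg|f IHf g IHg|f IHf] x y /=.
- by move->; exists 0.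
- by move->; exists 0.
- by move->; exists 0.
- by move->; exists 0.
- move=> [u [v [/IHf[k1 H1] /IHg[k2 H2] ->]]]; exists (maxn k1 k2) => k.
  by rewrite geq_max => /andP[/H1-> /H2->].
- move=> [z [/IHg[k1 H1] /IHf[k2 H2]]]; exists (maxn k1 k2) => k.
  by rewrite geq_max => /andP[/H1-> /H2].
- rewrite -/(fst_of x) -/(snd_of x); elim: (snd_of x) y => [|m IH] y /=.
    exact: IHf.
  move=> [z [/IH[k1 H1] /IHg[k2 H2]]]; exists (maxn k1 k2) => k.
  by rewrite geq_max => /andP[/H1-> /H2].
- move=> [/IHf[k1 H1] small].
  have [k2 H2] : exists k0, forall m, m < y -> forall k, k0 <= k ->
      exists v, bounded_eval f k (cpair x m) = v.+2.
    elim: y {H1} small => [|y IH] small; first by exists 0.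
    have [|k2 H2] := IH; first by move=> m my; apply: small; apply: ltnW.
    have [v /IHf[k3 H3]] := small y (ltnSn y).
    exists (maxn k2 k3) => m; rewrite ltnS leq_eqVlt => my k.
    rewrite geq_max => /andP[k2k k3k]; move: my => /orP[/eqP->|my].
      by exists v; apply: H3.
    exact: H2.
  exists (maxn y.+1 (maxn k1 k2)) => k; rewrite !geq_max => /and3P[yk k1k k2k].
  set s := nat_rec _ _ _.
  have sS j : s j.+1 = if s j is r.+1 then r.+1 else
      if bounded_eval f k (cpair x j) is v.+1 then
        if v is _.+1 then 0 else j.+2
      else 1.
    by [].
  have s0 j : j <= y -> s j = 0.
    elim: j => // j IH jy; rewrite sS IH ?(ltnW jy) //.
    by have [v ->] := H2 j jy k k2k.
  have sy d : s (y.+1 + d) = y.+2.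
    elim: d => [|d IH]; last by rewrite addnS sS IH.
    by rewrite addn0 sS s0 // H1.
  by rewrite -(subnKC yk) sy.
Qed.

(** * The reduction *)

Lemma expr_code_inj (A : finType) : injective (@expr_code A).
Proof.
elim=> [||a|n|e IHe f IHf|e IHe f IHf|e IHe];
  case=> [||a'|n'|e' f'|e' f'|e'] //= /cpair_inj[//= _].
- by move/ord_inj/enum_rank_inj->.
- by move->.
- by move/cpair_inj=> [/IHe-> /IHf->].
- by move/cpair_inj=> [/IHe-> /IHf->].
- by move/IHe->.
Qed.

Lemma equation_code_inj (A : finType) : injective (@equation_code A).
Proof.
by move=> [e f] [e' f'] /cpair_inj[] /= /expr_code_inj-> /expr_code_inj->.
Qed.

(** The code of the equation of a program on input [x], where [x] itself
    provides the codes of the two expressions that depend on the program. This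
    is how a program gets hold of its own equation. *)
Definition halting_code (x : nat) : nat :=
  let faulty_code := fst_of (fst_of x) in
  let end_code := snd_of (fst_of x) in
  let letter a := cpair 3 (event_index a) in
  let dot a z := cpair 5 (cpair (letter a) z) in
  cpair (cpair 4 (cpair faulty_code
                   (dot Tick (iter x (dot (Up 0)) end_code)))) faulty_code.

Definition halting_equation (A : Type) (c : cmd) (m : nat) : equation A :=
  (Plus (faulty A c) (runs A c m), faulty A c).

Transparent ev.

Lemma halting_codeE (A : finType) c n :
  let p := cpair (expr_code (faulty A c))
                 (expr_code (Dot (paths A c) (ev A (Down 0)))) in
  halting_code (cpair p n) = equation_code (halting_equation A c (cpair p n)).
Proof.
move=> p; rewrite /halting_code !fst_cpair snd_cpair /equation_code /=.
by do 5!congr cpair; elim: (cpair p n) => //= m ->.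
Qed.

Lemma computable_halting_code : computable halting_code.
Proof.
have [F S I] := And3 computable_fst computable_snd computable_id.
have cst := computable_const; have FF := computable_comp F F.
have dot a f : computable f ->
    computable (fun x => cpair 5 (cpair (cpair 3 (event_index a)) (f x))).
  by move=> cf; do 2![apply: computable_pair (cst _) _].
apply: computable_pair (FF); apply: computable_pair (cst _) _.
apply: computable_pair (FF) _; apply: (dot).
have [c Hc] : computable (fun x => nat_rec (fun=> nat) (snd_of (fst_of x))
    (fun m z => cpair 5 (cpair (cpair 3 (event_index (Up 0))) z)) x).
  apply: (@computable_rec _ id (fun x m z => cpair 5 (cpair _ z))).
  - exact: computable_comp S F.
  - exact: I.
  - by apply: (dot); apply: (computable_comp S S).
exists c => x; have := Hc x; congr eval.
Qed.

Theorem theorem37 (A : finType) (card_A : 1 < #|A|) (U : set (equation A))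
    (U_re : rec_enum (codes U))
    (U_extends : forall e f : expr A, derivable e f -> U (e, f))
    (U_sound : forall e f : expr A, U (e, f) -> valid e f) :
  sigma01_complete (codes U).
Proof.
split=> // P [cP HP]; have [cU HU] := U_re.
have [F S I] := And3 computable_fst computable_snd computable_id.
have cst := computable_const.
have FF := computable_comp F F; have SF := computable_comp S F.
have codeF := computable_comp computable_halting_code F.
pose foundP x k := bounded_eval cP k (snd_of x).
pose foundU x k := bounded_eval cU k (halting_code x).
have [search Hsearch] : computable2 (fun x k =>
    if foundP x k is _.+1 then 0 else if foundU x k is _.+1 then 0 else 1).
  apply: computable_case _ _ (cst 0).
    exact: computable_comp2 (computable_bounded_eval cP) S SF.
  apply: computable_case (cst 1) (cst 0).
  exact: computable_comp2 (computable_bounded_eval cU) S codeF.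
have [verdict Hverdict] : computable2 (fun x k =>
    if foundP x k is _.+1 then 0 else 1).
  apply: computable_case (cst 1) (cst 0).
  exact: computable_comp2 (computable_bounded_eval cP) S SF.
(* The argument is handed on next to the number found by the search. *)
have [idc Hid] := I.
pose race := RComp verdict (RPair idc (RMin search)).
pose prog := compile race.
(* The search does not depend on the expressions built from [prog]: they reach
   [prog] with its input, which is what closes the circle. *)
pose p := cpair (expr_code (faulty A prog))
                (expr_code (Dot (paths A prog) (ev A (Down 0)))).
pose E n := halting_equation A prog (cpair p n).
have codeE n : halting_code (cpair p n) = equation_code (E n).
  exact: halting_codeE.
(* At the first number where the search succeeds, [prog] halts, and its result
   decides the membership of its own equation in U. *)
have raceP n : (exists k, 0 < foundP (cpair p n) k + foundU (cpair p n) k) ->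
    exists k, 0 < foundP (cpair p n) k + foundU (cpair p n) k /\
      if foundP (cpair p n) k is _.+1 then U (E n) else ~ U (E n).
  move=> found; exists (ex_minn found); case: ex_minnP => k fk kmin; split=> //.
  have ev_race : eval race (cpair p n)
      (if foundP (cpair p n) k is _.+1 then 0 else 1).
    exists (cpair (cpair p n) k); split.
      exists (cpair p n), k; split=> //; split=> [|m mk].
        have := Hsearch (cpair (cpair p n) k); rewrite fst_cpair snd_cpair.
        by move: fk; case: (foundP _ k) => //=; case: (foundU _ k).
      exists 0; have := Hsearch (cpair (cpair p n) m).
      rewrite fst_cpair snd_cpair.
      have : ~~ (0 < foundP (cpair p n) m + foundU (cpair p n) m).
        by apply/negP => /kmin; rewrite leqNgt mk.
      by case: (foundP _ m) => //=; case: (foundU _ m).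
    by have := Hverdict (cpair (cpair p n) k); rewrite fst_cpair snd_cpair.
  have start : memory [:: cpair p n] = upd 0 (cpair p n) (fun=> 0).
    by apply/funext => -[|r]; rewrite /memory //= nth_nil.
  have := exec_compile ev_race; rewrite start -/prog.
  case: (foundP _ k) => [|v] ex.
  - have [a [b ab]] : exists a b : A, a <> b.
      have /card_gt1P[a [b [_ _ /eqP ab]]] := card_A; by exists a, b.
    by move/U_sound; apply: (not_valid_faulty ab ex).
  - exact/U_extends/(derivable_faulty A ex erefl).
exists (fun n => halting_code (cpair p n)).
  exact: computable_comp computable_halting_code (computable_pair (cst p) I).
move=> n; rewrite codeE; split.
- move=> /HP[y /bounded_eval_complete[k /(_ k (leqnn k)) foundk]].
  have [|j [fj]] := raceP n.
    by exists k; rewrite /foundP snd_cpair foundk.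
  case: (foundP _ j) fj => [|v _ UE]; last by exists (E n).
  rewrite add0n /foundU.
  case EU: (bounded_eval _ _ _) => [//|v] _ _.
  by rewrite -codeE; apply/HU; exists v; apply: bounded_eval_sound EU.
- move=> [E' UE' /equation_code_inj EE'].
  have {E' UE' EE'}UE : U (E n) by rewrite -EE'.
  have /HU[y /bounded_eval_complete[k /(_ k (leqnn k)) foundk]] :
      codes U (equation_code (E n)) by exists (E n).
  have [|j [fj]] := raceP n.
    by exists k; rewrite addnC /foundU codeE foundk.
  case Ej: (foundP _ j) => [//|v] _.
  apply/HP; exists v; move: Ej.
  by rewrite /foundP snd_cpair => /bounded_eval_sound.
Qed.
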